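(* Let $\Phi:C_1\leftrightsquigarrow C_2$ be a birational map between projective algebraic curves. Let $A$ and $B$ be generalised weighted sets on $C_2$ of the same total multiplicity, with corresponding generalised weighted sets $[\Phi]^*A$ and $[\Phi]^*B$ on $C_1$. Then $A\equiv B$ if and only if $[\Phi]^*A\equiv[\Phi]^*B$. This holds both for the relation $\equiv$ on effective weighted sets (when $A,B$ are effective) and for the relation $\equiv$ on generalised weighted sets.
   Context: $L$ is an algebraically closed field of arbitrary characteristic. A (projective) algebraic curve is a closed irreducible subvariety $C\subset P^w$ of dimension $1$ over $L$, possibly singular. Branches: let $\nu:C^{ns}\to C$ be the non-singular model (normalisation). The branches $\gamma$ of $C$ centred at $p\in C$ correspond to (and may be identified with) the points $q\in\nu^{-1}(p)$. For a form $\phi$ of degree $e$ on $P^w$ not vanishing identically on $C$, $I_\gamma(C,\phi)$ is the order of vanishing at $q$ of $\nu^*(\phi/l^e)$, where $l$ is a linear form with $l(p)\neq0$. An (effective) weighted set on $C$ is a finite formal sum $n_1\gamma_1+\dots+n_k\gamma_k$ of branches with non-negative integer coefficients; its total multiplicity is $n_1+\dots+n_k$. If $\phi$ has finite intersection with $C$, $C\sqcap\phi=\sum_\gamma I_\gamma(C,\phi)\gamma$, of total multiplicity $e\deg(C)$. A linear system $\Sigma$ is the projectivisation of a finite dimensional vector space of forms of a fixed degree $e$, its dimension being the projective dimension. $Series(\Sigma)$ is the collection of the $C\sqcap\phi$ for $\phi\in\Sigma$ having finite intersection with $C$ (at least one such form is assumed to exist); its order is $e\deg(C)$ and its dimension is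 the least integer $r$ such that every weighted set of $Series(\Sigma)$ is of the form $C\sqcap\phi$ with $\phi$ in some fixed linear subsystem $\Sigma'\subset\Sigma$ of dimension $r$. A $g_n^r$ on $C$ is a collection of weighted sets of the form $\{W-W_0:W\in Series(\Sigma)\}$, for some $\Sigma$ with $r=dimension(Series(\Sigma))$ and some (possibly zero) weighted set $W_0$ contained in every $W\in Series(\Sigma)$, where $n=order(Series(\Sigma))$ minus the total multiplicity of $W_0$. Linear equivalence of effective weighted sets: for effective weighted sets $A,B$ of the same total multiplicity $n$, $A\equiv B$ if there is a $g_n^r$ on the curve (for some $r$) to which both $A$ and $B$ belong. A generalised weighted set is a finite formal sum of branches with integer coefficients; its total multiplicity is the sum of the coefficients. It can be written uniquely as $A_1-A_2$ with $A_1,A_2$ disjoint effective weighted sets. If $A=A_1-A_2$ and $B=B_1-B_2$ (in this unique form) have the same total multiplicity, then $A\equiv B$ means $A_1+B_2\equiv B_1+A_2$ as effective weighted sets. Birational maps: $\Phi$ lifts to an isomorphism $C_1^{ns}\cong C_2^{ns}$, hence induces a bijection $[\Phi]^*$ from the branches of $C_2$ to the branches of $C_1$, extended linearly to generalised weighted sets. *)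

(* Defs.v *)
From HB Require Import structures.
From mathcomp Require Import all_boot all_order all_algebra.
From mathcomp Require Import boolp classical_sets ring.
From mathcomp Require Import mpoly freeg.

Set Implicit Arguments.
Unset Strict Implicit.
Unset Printing Implicit Defensive.

Import Order.TTheory GRing.Theory Num.Theory.

Local Open Scope classical_set_scope.
Local Open Scope quotient_scope.
Local Open Scope ring_scope.

(** A point of P^w is given by a nonzero vector of homogeneous coordinates;
    a subset of P^w is represented by the set of all homogeneous coordinates
    of its points. *)

Definition hcoord (L : closedFieldType) (w : nat) := 'I_w.+1 -> L.

Definition is_point (L : closedFieldType) (w : nat) (x : hcoord L w) : Prop :=
  exists i, x i != 0.

Definition same_point (L : closedFieldType) (w : nat) (x y : hcoord L w) : Prop :=
  exists2 c : L, c != 0 & forall i, y i = c * x i.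

Definition zero_locus (L : closedFieldType) (w : nat)
    (F : set {mpoly L[w.+1]}) : set (hcoord L w) :=
  [set x | is_point x /\ forall f, F f -> f.@[x] = 0].

Definition proj_closed (L : closedFieldType) (w : nat)
    (X : set (hcoord L w)) : Prop :=
  exists2 F : set {mpoly L[w.+1]},
    (forall f, F f -> exists d : nat, f \is d.-homog) & X = zero_locus F.

Definition proj_irreducible (L : closedFieldType) (w : nat)
    (X : set (hcoord L w)) : Prop :=
  X !=set0 /\
  forall Y Z : set (hcoord L w), proj_closed Y -> proj_closed Z ->
    X `<=` Y `|` Z -> X `<=` Y \/ X `<=` Z.

Record variety (L : closedFieldType) (w : nat) := Variety {
  vpts :> set (hcoord L w);
  vpts_closed : proj_closed vpts;
  vpts_irreducible : proj_irreducible vpts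
}.

Definition vanishes_on (L : closedFieldType) (w : nat) (X : set (hcoord L w))
    (f : {mpoly L[w.+1]}) : Prop :=
  forall x, X x -> f.@[x] = 0.

Section VarietyLemmas.
Context (L : closedFieldType) (w : nat) (X : variety L w).
Implicit Types (a b : {mpoly L[w.+1]}).

Lemma variety_is_point (x : hcoord L w) : vpts X x -> is_point x.
Proof. by case: (vpts_closed X) => F _ -> []. Qed.

Lemma proj_closed1 d a : a \is d.-homog -> proj_closed (zero_locus [set a]).
Proof. by move=> ha; exists [set a] => // f ->; exists d. Qed.

Lemma vanishes_onM d e a b : a \is d.-homog -> b \is e.-homog ->
  vanishes_on X (a * b) -> vanishes_on X a \/ vanishes_on X b.
Proof.
move=> ha hb hab; have [_ irr] := vpts_irreducible X.
have [x Xx|h|h] := irr _ _ (proj_closed1 ha) (proj_closed1 hb).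
- have /eqP := hab x Xx; rewrite mevalM mulf_eq0 => /orP[] /eqP h.
    by left; split; [exact: variety_is_point | move=> f ->].
  by right; split; [exact: variety_is_point | move=> f ->].
- by left=> x /h[_]; apply.
- by right=> x /h[_]; apply.
Qed.

Lemma vanishes_on_away d e a b : a \is d.-homog -> b \is e.-homog ->
  ~ vanishes_on X b -> (forall x, vpts X x -> b.@[x] != 0 -> a.@[x] = 0) ->
  vanishes_on X a.
Proof.
move=> ha hb nb h; have [//|//|//] := @vanishes_onM d e a b ha hb _.
move=> x Xx; rewrite mevalM; have [->|/(h x Xx) ->] := eqVneq b.@[x] 0.
  by rewrite mulr0.
by rewrite mul0r.
Qed.

End VarietyLemmas.

(** Rational functions are classes of quotients a/b of forms of the same
    degree, with b not vanishing identically on X; a/b and a'/b' are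
    identified when a b' = a' b on X. *)

Definition admissible (L : closedFieldType) (w : nat) (X : variety L w)
    (a b : {mpoly L[w.+1]}) : Prop :=
  (exists d : nat, a \is d.-homog /\ b \is d.-homog) /\ ~ vanishes_on X b.

Record quot (L : closedFieldType) (w : nat) (X : variety L w) := Quot {
  qnum : {mpoly L[w.+1]};
  qden : {mpoly L[w.+1]};
  quotP : admissible X qnum qden
}.

HB.instance Definition _ (L : closedFieldType) w (X : variety L w) :=
  gen_eqMixin (quot X).
HB.instance Definition _ (L : closedFieldType) w (X : variety L w) :=
  gen_choiceMixin (quot X).

Section FunctionField.
Context (L : closedFieldType) (w : nat) (X : variety L w).
Implicit Types (q r s : quot X) (a b c : {mpoly L[w.+1]}).

Definition quot_eqv q r : Prop :=
  forall x, vpts X x -> (qnum q).@[x] * (qden r).@[x] = (qnum r).@[x] * (qden q).@[x].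

Definition quot_eqvb q r : bool := `[< quot_eqv q r >].

Lemma quot_eqvb_refl : reflexive quot_eqvb.
Proof. by move=> q; apply/asboolP => x _. Qed.

Lemma quot_eqvb_sym : ssrbool.symmetric quot_eqvb.
Proof. by move=> q r; apply/asboolP/asboolP => h x /h ->. Qed.

Lemma quot_eqvb_trans : transitive quot_eqvb.
Proof.
move=> r q s /asboolP h1 /asboolP h2; apply/asboolP => x Xx; apply/eqP.
rewrite -subr_eq0 -!mevalM -mevalB; apply/eqP; move: x Xx.
have [[d [hq hq']] _] := quotP q; have [[e [hr hr']] nr] := quotP r.
have [[f [hs hs']] _] := quotP s.
apply: (vanishes_on_away (d := d + f) (b := qden r)) hr' nr _.
  by have h := dhomogM hs hq'; rewrite addnC in h; exact: rpredB (dhomogM hq hs') h.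
move=> x Xx r0; apply: (mulIf r0); rewrite mul0r mevalB !mevalM.
have e1 := h1 x Xx; have e2 := h2 x Xx.
transitivity (((qnum q).@[x] * (qden r).@[x]) * (qden s).@[x]
   - ((qnum s).@[x] * (qden r).@[x]) * (qden q).@[x]); first by ring.
by rewrite e1 -e2; ring.
Qed.

Canonical quot_equiv :=
  EquivRel quot_eqvb quot_eqvb_refl quot_eqvb_sym quot_eqvb_trans.

Definition funfield := {eq_quot quot_eqvb}.

HB.instance Definition _ : EqQuotient _ quot_eqvb funfield :=
  EqQuotient.on funfield.
HB.instance Definition _ := Choice.on funfield.

Lemma pi_funfieldP q r : \pi_funfield q = \pi_funfield r <-> quot_eqv q r.
Proof. by split=> [/eqmodP/asboolP|h]; last exact/eqmodP/asboolP. Qed.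

Lemma repr_funfieldP q : quot_eqv (repr (\pi_funfield q)) q.
Proof. by apply/pi_funfieldP; rewrite reprK. Qed.

Lemma admissible_scalar (c : L) : admissible X c%:MP 1.
Proof.
split; first by exists 0%N; rewrite dhomog1 -[c%:MP]mulr1 mul_mpolyC rpredZ ?dhomog1.
case: (vpts_irreducible X) => -[x Xx] _ /(_ x Xx) /eqP.
by rewrite meval1 oner_eq0.
Qed.

Lemma nvanishesM q r : ~ vanishes_on X (qden q * qden r).
Proof.
have [[d [_ hq]] nq] := quotP q; have [[e [_ hr]] nr] := quotP r.
by case/(vanishes_onM hq hr).
Qed.

Lemma admissible_add q r :
  admissible X (qnum q * qden r + qnum r * qden q) (qden q * qden r).
Proof.
split; last exact: nvanishesM.
have [[d [hq hq']] _] := quotP q; have [[e [hr hr']] _] := quotP r.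
exists (d + e)%N; split; last exact: dhomogM.
by have h := dhomogM hr hq'; rewrite addnC in h; exact: rpredD (dhomogM hq hr') h.
Qed.

Lemma admissible_opp q : admissible X (- qnum q) (qden q).
Proof.
have [[d [hq hq']] nq] := quotP q; split=> //.
by exists d; rewrite rpredN.
Qed.

Lemma admissible_mul q r : admissible X (qnum q * qnum r) (qden q * qden r).
Proof.
split; last exact: nvanishesM.
have [[d [hq hq']] _] := quotP q; have [[e [hr hr']] _] := quotP r.
by exists (d + e)%N; split; exact: dhomogM.
Qed.

Lemma admissible_inv q :
  ~ vanishes_on X (qnum q) -> admissible X (qden q) (qnum q).
Proof. by have [[d [hq hq']] _] := quotP q => h; split=> //; exists d. Qed.

Definition quot_scalar (c : L) := Quot (admissible_scalar c).
Definition quot_add q r := Quot (admissible_add q r).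
Definition quot_opp q := Quot (admissible_opp q).
Definition quot_mul q r := Quot (admissible_mul q r).
Definition quot_inv q :=
  match pselect (vanishes_on X (qnum q)) with
  | left _ => quot_scalar 0
  | right h => Quot (admissible_inv h)
  end.

Implicit Types (f g h : funfield).

Definition ff_scalar (c : L) : funfield := \pi_funfield (quot_scalar c).
Definition ff_add f g : funfield := \pi_funfield (quot_add (repr f) (repr g)).
Definition ff_opp f : funfield := \pi_funfield (quot_opp (repr f)).
Definition ff_mul f g : funfield := \pi_funfield (quot_mul (repr f) (repr g)).
Definition ff_inv f : funfield := \pi_funfield (quot_inv (repr f)).

Lemma ff_addE q r :
  ff_add (\pi_funfield q) (\pi_funfield r) = \pi_funfield (quot_add q r).
Proof.
apply/pi_funfieldP => x Xx /=; rewrite !(mevalD, mevalM).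
have := repr_funfieldP q Xx; have := repr_funfieldP r Xx.
move: (repr _) (repr _) => q' r' e1 e2.
by apply/eqP; rewrite -subr_eq0; apply/eqP; ring: e1 e2.
Qed.

Lemma ff_oppE q : ff_opp (\pi_funfield q) = \pi_funfield (quot_opp q).
Proof.
apply/pi_funfieldP => x Xx /=; rewrite !mevalN.
by rewrite !mulNr (repr_funfieldP q Xx).
Qed.

Lemma ff_mulE q r : ff_mul (\pi_funfield q) (\pi_funfield r) = \pi_funfield (quot_mul q r).
Proof.
apply/pi_funfieldP => x Xx /=; rewrite !mevalM.
by rewrite mulrACA (repr_funfieldP q Xx) (repr_funfieldP r Xx) mulrACA.
Qed.

Lemma ff_addA : associative ff_add.
Proof.
elim/quotW=> q; elim/quotW=> r; elim/quotW=> s.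
rewrite (ff_addE r s) (ff_addE q r) !ff_addE.
by apply/pi_funfieldP => x _ /=; rewrite !(mevalD, mevalM); ring.
Qed.

Lemma ff_addC : commutative ff_add.
Proof.
elim/quotW=> q; elim/quotW=> r; rewrite !ff_addE.
by apply/pi_funfieldP => x _ /=; rewrite !(mevalD, mevalM); ring.
Qed.

Lemma ff_add0 : left_id (ff_scalar 0) ff_add.
Proof.
elim/quotW=> q; rewrite /ff_scalar ff_addE.
by apply/pi_funfieldP => x _ /=; rewrite !(mevalD, mevalM, mevalC, meval1); ring.
Qed.

Lemma ff_addN : left_inverse (ff_scalar 0) ff_opp ff_add.
Proof.
elim/quotW=> q; rewrite ff_oppE ff_addE.
apply/pi_funfieldP => x _ /=.
by rewrite !(mevalD, mevalM, mevalC, meval1, mevalN); ring.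
Qed.

HB.instance Definition _ :=
  GRing.isZmodule.Build funfield ff_addA ff_addC ff_add0 ff_addN.

Lemma ff_mulA : associative ff_mul.
Proof.
elim/quotW=> q; elim/quotW=> r; elim/quotW=> s.
rewrite (ff_mulE r s) (ff_mulE q r) !ff_mulE.
by apply/pi_funfieldP => x _ /=; rewrite !mevalM; ring.
Qed.

Lemma ff_mulC : commutative ff_mul.
Proof.
elim/quotW=> q; elim/quotW=> r; rewrite !ff_mulE.
by apply/pi_funfieldP => x _ /=; rewrite !mevalM; ring.
Qed.

Lemma ff_mul1 : left_id (ff_scalar 1) ff_mul.
Proof.
elim/quotW=> q; rewrite /ff_scalar ff_mulE.
by apply/pi_funfieldP => x _ /=; rewrite !(mevalM, mevalC, meval1); ring.
Qed.

Lemma ff_mulDl : left_distributive ff_mul ff_add.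
Proof.
elim/quotW=> q; elim/quotW=> r; elim/quotW=> s.
rewrite (ff_addE q r) (ff_mulE q s) (ff_mulE r s) ff_mulE ff_addE; apply/pi_funfieldP => x _ /=.
by rewrite !(mevalD, mevalM); ring.
Qed.

Lemma pi_eq0 q : \pi_funfield q = ff_scalar 0 <-> vanishes_on X (qnum q).
Proof.
rewrite pi_funfieldP; split=> h x Xx; have := h x Xx;
  by rewrite /= meval1 mulr1 mevalC mul0r.
Qed.

Lemma ff_1neq0 : ff_scalar 1 != ff_scalar 0.
Proof.
apply/eqP => /pi_eq0 /=; case: (vpts_irreducible X) => -[x Xx] _ /(_ x Xx) /eqP.
by rewrite mevalC oner_eq0.
Qed.

HB.instance Definition _ :=
  GRing.Zmodule_isComNzRing.Build funfield ff_mulA ff_mulC ff_mul1 ff_mulDl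
    ff_1neq0.

Lemma ff_mulV f : f != ff_scalar 0 -> ff_mul (ff_inv f) f = ff_scalar 1.
Proof.
rewrite -[f in f != _]reprK => /eqP f0; rewrite -[f in ff_mul _ f]reprK /ff_inv ff_mulE.
apply/pi_funfieldP => x Xx; rewrite /quot_inv.
case: pselect => [/pi_eq0 //|nv] /=.
by rewrite !(mevalM, mevalC, meval1); ring.
Qed.

Lemma ff_inv0 : ff_inv (ff_scalar 0) = ff_scalar 0.
Proof.
rewrite /ff_inv /quot_inv; case: pselect => // h.
by case: h; apply/pi_eq0; rewrite reprK.
Qed.

HB.instance Definition _ :=
  GRing.ComNzRing_isField.Build funfield ff_mulV ff_inv0.

(** The rational function a/b, and 0 by convention if the quotient makes no
    sense. *)
Definition ratfun a b : funfield :=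
  match pselect (admissible X a b) with
  | left h => \pi_funfield (Quot h)
  | right _ => 0
  end.

End FunctionField.

(** The dimension of a variety is the transcendence degree over L of its
    function field. *)

Definition alg_independent (L : closedFieldType) (w : nat) (X : variety L w)
    (n : nat) (t : 'I_n -> funfield X) : Prop :=
  forall P : {mpoly L[n]}, mmap (@ff_scalar L w X) t P = 0 -> P = 0.

Definition variety_dim (L : closedFieldType) (w : nat) (X : variety L w)
    (d : nat) : Prop :=
  (exists t : 'I_d -> funfield X, alg_independent t) /\
  forall t : 'I_d.+1 -> funfield X, ~ alg_independent t.

Record curve (L : closedFieldType) (w : nat) := Curve {
  curve_variety :> variety L w;
  curve_dim1 : variety_dim curve_variety 1
}.

(** The non-singular model of C is taken to be the abstract non-singular curve
    of the function field of C: its points are the discrete valuation rings of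
    L(C) over L, given here by their normalised valuations.  The value at 0,
    which should be +oo, is fixed to be the junk value 0, so that a valuation
    ring determines its branch. *)

Record branch (L : closedFieldType) (w : nat) (C : curve L w) := Branch {
  bval : funfield C -> int;
  bval0 : bval 0 = 0;
  bvalM : forall f g, f != 0 -> g != 0 -> bval (f * g) = bval f + bval g;
  bvalD : forall f g, f != 0 -> g != 0 -> f + g != 0 ->
    Num.min (bval f) (bval g) <= bval (f + g);
  bval_scalar : forall c : L, bval (ff_scalar C c) = 0;
  bval_normalised : exists2 f, f != 0 & bval f = 1
}.

HB.instance Definition _ (L : closedFieldType) w (C : curve L w) :=
  gen_eqMixin (branch C).
HB.instance Definition _ (L : closedFieldType) w (C : curve L w) :=
  gen_choiceMixin (branch C).

Section Branches.
Context (L : closedFieldType) (w : nat) (C : curve L w).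
Implicit Types (g : branch C) (p : hcoord L w).

Definition val_ring g : set (funfield C) := [set f | f = 0 \/ 0 <= bval g f].
Definition val_ideal g : set (funfield C) := [set f | f = 0 \/ 0 < bval g f].

Definition local_ring p : set (funfield C) :=
  [set f | exists a b, [/\ admissible C a b, b.@[p] != 0 & f = ratfun C a b]].
Definition local_ideal p : set (funfield C) :=
  [set f | exists a b,
     [/\ admissible C a b, b.@[p] != 0, a.@[p] = 0 & f = ratfun C a b]].

(** nu maps the point g of the non-singular model to p: the local ring of g
    dominates that of p. *)
Definition centred g p : Prop :=
  [/\ vpts C p, local_ring p `<=` val_ring g & local_ideal p `<=` val_ideal g].

(** n = I_g(C, phi), for a form phi of degree e. *)
Definition int_mult g (e : nat) (phi : dhomog w.+1 L e) (n : int) : Prop :=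
  exists p l, [/\ centred g p, l \is 1.-homog, l.@[p] != 0
                & n = bval g (ratfun C (val phi) (l ^+ e))].

End Branches.

(** Generalised weighted sets; the effective ones are those with [fgle 0 A],
    and the total multiplicity is [deg A]. *)
Definition wset (L : closedFieldType) (w : nat) (C : curve L w) :=
  {freeg (branch C) / int}.

Section Series.
Context (L : closedFieldType) (w : nat) (C : curve L w).
Implicit Types (W A B : wset C).

Definition finite_intersection e (phi : dhomog w.+1 L e) : Prop :=
  exists s : seq (hcoord L w), forall x, vpts C x -> (val phi).@[x] = 0 ->
    exists2 y, List.In y s & same_point y x.

Definition cut_out e (phi : dhomog w.+1 L e) W : Prop :=
  forall g : branch C, int_mult g phi (coeff g W).

(** The linear systems of forms of degree e are the projectivisations of the
    subspaces Sigma : {vspace dhomog w.+1 L e}. *)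
Definition series e (Sigma : {vspace dhomog w.+1 L e}) : set (wset C) :=
  [set W | exists phi, [/\ phi \in Sigma, finite_intersection phi & cut_out phi W]].

Definition series_within e (Sigma : {vspace dhomog w.+1 L e}) (r : nat) : Prop :=
  exists Sigma' : {vspace dhomog w.+1 L e},
    [/\ (Sigma' <= Sigma)%VS, \dim Sigma' = r.+1 & series Sigma `<=` series Sigma'].

Definition series_dim e (Sigma : {vspace dhomog w.+1 L e}) (r : nat) : Prop :=
  series_within Sigma r /\ forall s, series_within Sigma s -> (r <= s)%N.

(** The degree of C is the number of intersections, counted with multiplicity,
    of C with a hyperplane that does not contain it. *)
Definition curve_degree (d : int) : Prop :=
  exists (l : dhomog w.+1 L 1) W,
    [/\ finite_intersection l, cut_out l W & d = deg W].

Definition series_order e (Sigma : {vspace dhomog w.+1 L e}) (n : int) : Prop :=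
  exists2 d, curve_degree d & n = e%:Z * d.

Definition is_gnr (n r : nat) (G : set (wset C)) : Prop :=
  exists e (Sigma : {vspace dhomog w.+1 L e}) (W0 : wset C) (m : int),
    [/\ exists2 phi, phi \in Sigma & finite_intersection phi,
        series_dim Sigma r,
        series_order Sigma m,
        fgle 0 W0 /\ forall W, series Sigma W -> fgle W0 W
      & n%:Z = m - deg W0 /\ G = [set W - W0 | W in series Sigma]].

Definition eff_equiv A B : Prop :=
  [/\ fgle 0 A, fgle 0 B &
      exists (n r : nat) (G : set (wset C)),
        [/\ deg A = n, deg B = n, is_gnr n r G, G A & G B]].

(** [fgpos A - fgneg A] is the decomposition of A as a difference of disjoint
    effective weighted sets. *)
Definition gen_equiv A B : Prop :=
  deg A = deg B /\ eff_equiv (fgpos A + fgneg B) (fgpos B + fgneg A).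

End Series.

Definition rm_image_of (L : closedFieldType) (w1 w2 : nat)
    (F : w2.+1.-tuple {mpoly L[w1.+1]}) (x : hcoord L w1) : hcoord L w2 :=
  fun i => (tnth F i).@[x].

(** A rational map is represented by forms of a common degree, not all
    vanishing identically on X. *)
Record rational_map (L : closedFieldType) (w1 w2 : nat)
    (X : variety L w1) (Y : variety L w2) := RationalMap {
  rm_forms :> w2.+1.-tuple {mpoly L[w1.+1]};
  rm_homog : exists d : nat, forall i, tnth rm_forms i \is d.-homog;
  rm_nonzero : exists2 x, vpts X x & is_point (rm_image_of rm_forms x);
  rm_maps : forall x, vpts X x -> is_point (rm_image_of rm_forms x) ->
    vpts Y (rm_image_of rm_forms x)
}.

(** G o F is defined and is the identity, as a rational map from X to X. *)
Definition rm_comp_id (L : closedFieldType) (w1 w2 : nat)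
    (X : variety L w1) (Y : variety L w2)
    (F : rational_map X Y) (G : rational_map Y X) : Prop :=
  (exists x, [/\ vpts X x, is_point (rm_image_of F x)
               & is_point (rm_image_of G (rm_image_of F x))]) /\
  forall x, vpts X x -> is_point (rm_image_of F x) ->
    is_point (rm_image_of G (rm_image_of F x)) ->
    same_point x (rm_image_of G (rm_image_of F x)).

Record birational (L : closedFieldType) (w1 w2 : nat)
    (X : variety L w1) (Y : variety L w2) := Birational {
  bir_map : rational_map X Y;
  bir_inv : rational_map Y X;
  bir_mapK : rm_comp_id bir_map bir_inv;
  bir_invK : rm_comp_id bir_inv bir_map
}.

Definition bir_sym (L : closedFieldType) (w1 w2 : nat)
    (X : variety L w1) (Y : variety L w2) (Phi : birational X Y) :
    birational Y X :=
  Birational (bir_invK Phi) (bir_mapK Phi).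

Definition ff_pull (L : closedFieldType) (w1 w2 : nat)
    (X : variety L w1) (Y : variety L w2) (F : rational_map X Y)
    (f : funfield Y) : funfield X :=
  ratfun X (qnum (repr f) \mPo F) (qden (repr f) \mPo F).

Lemma meval_homogZ (L : closedFieldType) (w d : nat) (a : {mpoly L[w.+1]})
    (c : L) (x y : hcoord L w) :
  a \is d.-homog -> (forall i, y i = c * x i) -> a.@[y] = c ^+ d * a.@[x].
Proof.
move=> /dhomogP ha hy; rewrite !mevalE mulr_sumr !big_seq.
apply: eq_bigr => m hm; rewrite mulrCA; congr (_ * _).
under eq_bigr do rewrite hy exprMn.
by rewrite big_split /= prodrXr -mdegE (ha _ hm).
Qed.

Lemma homog_comp (L : closedFieldType) (w1 w2 d e : nat)
    (F : w2.+1.-tuple {mpoly L[w1.+1]}) (a : {mpoly L[w2.+1]}) :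
  a \is d.-homog -> (forall i, tnth F i \is e.-homog) ->
  a \mPo F \is (d * e).-homog.
Proof.
move=> /dhomogP ha hF; rewrite comp_mpolyEX big_seq rpred_sum // => m hm.
have -> : d = (\sum_i m i)%N by rewrite -mdegE -(ha _ hm).
rewrite rpredZ // comp_mpolyX big_distrl /=.
apply: (big_ind2 (fun (p : {mpoly L[w1.+1]}) (n : nat) => p \is n.-homog)).
- exact: dhomog1.
- by move=> p n q k hp hq; exact: dhomogM.
- by move=> i _; rewrite mulnC; apply: dhomogMn.
Qed.

Lemma meval_comp (L : closedFieldType) (w1 w2 : nat)
    (F : w2.+1.-tuple {mpoly L[w1.+1]}) (a : {mpoly L[w2.+1]}) x :
  (a \mPo F).@[x] = a.@[rm_image_of F x].
Proof. exact: comp_mpoly_meval. Qed.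

Lemma ratfunE (L : closedFieldType) (w : nat) (X : variety L w) a b
    (h : admissible X a b) : ratfun X a b = \pi_(funfield X) (Quot h).
Proof.
rewrite /ratfun; case: pselect => // h'; exact/pi_funfieldP.
Qed.

Section Pullback.
Context (L : closedFieldType) (w1 w2 : nat).
Context (X : variety L w1) (Y : variety L w2) (Phi : birational X Y).
Local Notation F := (bir_map Phi).
Local Notation G := (bir_inv Phi).

Lemma vanishes_image d (a : {mpoly L[w2.+1]}) x :
  a \is d.-homog -> vanishes_on Y a -> vpts X x -> a.@[rm_image_of F x] = 0.
Proof.
move=> ha va Xx; have [pt|npt] := pselect (is_point (rm_image_of F x)).
  exact/va/rm_maps.
have [[y Yy] _] := vpts_irreducible Y.
rewrite (meval_homogZ (c := 0) (x := y) ha) ?va ?mulr0 // => i.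
by rewrite mul0r; apply/eqP; apply: contra_notT npt => h; exists i.
Qed.

Lemma vanishes_generic d (a : {mpoly L[w2.+1]}) : a \is d.-homog ->
  (forall (y : hcoord L w2) (c : L), vpts Y y -> vpts X (rm_image_of G y) -> c != 0 ->
     (forall i, rm_image_of F (rm_image_of G y) i = c * y i) -> a.@[y] = 0) ->
  vanishes_on Y a.
Proof.
move=> ha h; have [[y0 [Yy0 [j Gj] [i Fi]]] id] := bir_invK Phi.
have [eF hF] := rm_homog F; have [eG hG] := rm_homog G.
apply: (vanishes_on_away (b := tnth G j * (tnth F i \mPo G))) (ha) _ _ _.
- exact: dhomogM (hG j) (homog_comp (hF i) hG).
- move=> /(_ y0 Yy0) /eqP; rewrite mevalM meval_comp mulf_eq0.
  by rewrite (negbTE Gj) (negbTE Fi).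
- move=> y Yy; rewrite mevalM meval_comp mulf_eq0 negb_or => /andP[Gy Fy].
  have ptG : is_point (rm_image_of G y) by exists j.
  have ptF : is_point (rm_image_of F (rm_image_of G y)) by exists i.
  have [c c0 hc] := id y Yy ptG ptF.
  exact: (h y c Yy (rm_maps Yy ptG) c0 hc).
Qed.

Lemma admissible_pull (q : quot Y) :
  admissible X (qnum q \mPo F) (qden q \mPo F).
Proof.
have [[d [hn hd]] nd] := quotP q; have [e hF] := rm_homog F.
split; first by exists (d * e)%N; split; exact: homog_comp.
move=> v; apply: nd; apply: (vanishes_generic hd) => y c Yy XGy c0 hc.
have := v _ XGy; rewrite meval_comp (meval_homogZ hd hc) => /eqP.
by rewrite mulf_eq0 expf_eq0 (negbTE c0) andbF /= => /eqP.
Qed.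

Lemma ff_pullE (q : quot Y) :
  ff_pull F (\pi_(funfield Y) q) = \pi_(funfield X) (Quot (admissible_pull q)).
Proof.
rewrite /ff_pull (ratfunE (admissible_pull _)).
have := repr_funfieldP q; move: (repr _) => r e.
apply/pi_funfieldP => x Xx /=; rewrite !meval_comp.
have [[d [hn hd]] _] := quotP q; have [[d' [hn' hd']] _] := quotP r.
have h : qnum r * qden q - qnum q * qden r \is (d' + d).-homog.
  by have h := dhomogM hn hd'; rewrite addnC in h; exact: rpredB (dhomogM hn' hd) h.
apply/eqP; rewrite -subr_eq0 -!mevalM -mevalB; apply/eqP.
apply: (vanishes_image h) => // y Yy.
by rewrite mevalB !mevalM e // subrr.
Qed.

Lemma ff_pull_zmod : zmod_morphism (ff_pull F).
Proof.
elim/quotW=> q; elim/quotW=> r.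
have subE (w : nat) (V : variety L w) (s t : quot V) :
    \pi_(funfield V) s - \pi_(funfield V) t =
    \pi_(funfield V) (quot_add s (quot_opp t)).
  by rewrite -(ff_addE s (quot_opp t)) -ff_oppE.
rewrite subE !ff_pullE subE.
apply/pi_funfieldP => x Xx /=.
by rewrite !(meval_comp, mevalD, mevalM, mevalN); ring.
Qed.

Lemma ff_pull_monoid : monoid_morphism (ff_pull F).
Proof.
split.
  have -> : 1 = \pi_(funfield Y) (quot_scalar Y 1) by [].
  rewrite ff_pullE; apply/pi_funfieldP => x Xx /=.
  by rewrite !meval_comp !(mevalC, meval1).
elim/quotW=> q; elim/quotW=> r.
have mulE (w : nat) (V : variety L w) (s t : quot V) :
    \pi_(funfield V) s * \pi_(funfield V) t = \pi_(funfield V) (quot_mul s t).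
  exact: ff_mulE.
rewrite mulE !ff_pullE mulE.
by apply/pi_funfieldP => x Xx /=; rewrite !(meval_comp, mevalM).
Qed.

HB.instance Definition _ :=
  GRing.isZmodMorphism.Build (funfield Y) (funfield X) (ff_pull F) ff_pull_zmod.
HB.instance Definition _ :=
  GRing.isMonoidMorphism.Build (funfield Y) (funfield X) (ff_pull F)
    ff_pull_monoid.

Lemma ff_pull_scalar (c : L) : ff_pull F (ff_scalar Y c) = ff_scalar X c.
Proof.
rewrite ff_pullE; apply/pi_funfieldP => x Xx /=.
by rewrite !meval_comp !(mevalC, meval1).
Qed.

End Pullback.

Lemma ff_pullK (L : closedFieldType) (w1 w2 : nat)
    (X : variety L w1) (Y : variety L w2) (Phi : birational X Y) :
  cancel (ff_pull (bir_map Phi)) (ff_pull (bir_inv Phi)).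
Proof.
elim/quotW=> q; rewrite ff_pullE (@ff_pullE _ _ _ _ _ (bir_sym Phi)).
apply/pi_funfieldP => y Yy /=; apply/eqP.
rewrite -subr_eq0 -!mevalM -mevalB; apply/eqP; move: y Yy.
have [[d [hn hd]] _] := quotP q.
have [eF hF] := rm_homog (bir_map Phi); have [eG hG] := rm_homog (bir_inv Phi).
have h1 := homog_comp (homog_comp hn hF) hG.
have h2 := homog_comp (homog_comp hd hF) hG.
apply: (@vanishes_generic _ _ _ _ _ Phi (d * eF * eG + d)).
  by have h := dhomogM hn h2; rewrite addnC in h; exact: rpredB (dhomogM h1 hd) h.
move=> y c Yy _ _ hc; rewrite mevalB !mevalM !meval_comp.
by rewrite (meval_homogZ hn hc) (meval_homogZ hd hc); ring.
Qed.

(** The bijection from the branches of C2 to those of C1 induced by Phi: the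
    valuation v of L(C2) goes to its transport along the isomorphism
    L(C1) -> L(C2) inverse to the pull-back by Phi. *)
Section BranchPullback.
Context (L : closedFieldType) (w1 w2 : nat).
Context (C1 : curve L w1) (C2 : curve L w2) (Phi : birational C1 C2).
Context (g : branch C2).
Local Notation psi := (ff_pull (bir_map (bir_sym Phi))).

Let v (f : funfield C1) : int := bval g (psi f).

Lemma branch_pull0 : v 0 = 0.
Proof. by rewrite /v rmorph0 bval0. Qed.

Lemma branch_pullM f h : f != 0 -> h != 0 -> v (f * h) = v f + v h.
Proof. by move=> f0 h0; rewrite /v rmorphM bvalM ?fmorph_eq0. Qed.

Lemma branch_pullD f h : f != 0 -> h != 0 -> f + h != 0 ->
  Num.min (v f) (v h) <= v (f + h).
Proof.
by move=> f0 h0 fh0; rewrite /v rmorphD bvalD -?rmorphD ?fmorph_eq0.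
Qed.

Lemma branch_pull_scalar (c : L) : v (ff_scalar C1 c) = 0.
Proof. by rewrite /v ff_pull_scalar bval_scalar. Qed.

Lemma branch_pull_normalised : exists2 f, f != 0 & v f = 1.
Proof.
have [f f0 vf] := bval_normalised g; exists (ff_pull (bir_map Phi) f).
  by rewrite fmorph_eq0.
by rewrite /v ff_pullK.
Qed.

Definition branch_pull : branch C1 :=
  Branch branch_pull0 branch_pullM branch_pullD branch_pull_scalar
    branch_pull_normalised.

End BranchPullback.

Definition wset_pull (L : closedFieldType) (w1 w2 : nat)
    (C1 : curve L w1) (C2 : curve L w2) (Phi : birational C1 C2)
    (A : wset C2) : wset C1 :=
  \sum_(g <- dom A) << coeff g A *g branch_pull Phi g >>.

(* Main.v *)
From HB Require Import structures.
Require Import Defs.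
From mathcomp Require Import all_boot all_order all_algebra.
From mathcomp Require Import mpoly freeg.
From mathcomp Require Import boolp classical_sets ring zify.

(** Linear equivalence depends only on the function field of the curve: two
    effective weighted sets A and B of the same total multiplicity are
    equivalent if and only if A - B is the divisor of a rational function
    ([eff_equivP]).  A birational map induces an isomorphism of function fields
    under which the branches, seen as valuations, correspond to each other, so
    it carries a function with divisor A - B to a function with divisor
    [Phi]^*A - [Phi]^*B.  The relation on generalised weighted sets follows,
    since a bijection of the branches respects positive and negative parts.

    In [eff_equivP], if A + W0 and B + W0 are cut out by phi and psi then A - B
    is the divisor of phi / psi.  Conversely let f = a / b have divisor A - B.
    Multiplying a and b by a form c whose divisor is at least B
    ([form_through]), the pencil spanned by ac and bc, diminished by
    W0 = div (bc) - B, contains A and B.  For this to be a g_n^r, the integer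
    e deg C - deg W0 must be the multiplicity of A, that is, a form of degree e
    must cut out a weighted set of multiplicity e deg C.  The quotient of two
    forms of degree e being a rational function, this is the theorem that a
    principal divisor has degree zero ([principal_degree]).

    That theorem is proved for any field K which has finite rank over L(x) for
    every nonconstant x, as the function field of a curve does
    ([funfield_finite]).  Distinct discrete valuations being independent, the
    zeros of x, counted with multiplicity, give as many elements of K that are
    independent over L(x) ([zeros_independent]); so there are finitely many
    zeros.  Let n be their number.  The independent elements can be chosen with
    poles among those of x ([integral_multiple]); multiplied by 1, x, ..., x^l
    they become n (l + 1) elements, independent over L, of the Riemann-Roch
    space of l (x)_oo + D for a fixed D.  As that space has dimension at most
    1 + l deg (x)_oo + deg D ([RR_dim]), letting l grow gives
    n <= deg (x)_oo ([sum_pole_orders_ge]), and exchanging x and 1/x gives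
    equality.

    The bound on the dimension rests on two facts: the residue field of every
    valuation is L ([residue]), and a function without poles is constant, which
    means that a nonconstant x has a zero ([exists_zero]).  The latter is
    Chevalley's extension argument: a maximal subring in which x is not a unit
    is a valuation ring, and it is discrete because a long chain of divisors of
    y would be independent over L(y) ([divisor_chain_independent]).

    On the curve, the residues of the coordinate functions at a branch are the
    coordinates of its centre ([centre_exists]), and the multiplicity of a form
    of degree e at a branch is the value of its dehomogenisation plus e times
    the coefficient of a fixed hyperplane section ([hyperplane_divisor]). *)

Set Implicit Arguments.
Unset Strict Implicit.
Unset Printing Implicit Defensive.
Import Order.TTheory GRing.Theory Num.Theory.
Local Open Scope quotient_scope.
Local Open Scope ring_scope.


(** * Valuations of a function field of one variable *)

Section FunctionFields.
Context (L : closedFieldType) (K : fieldType) (emb : {rmorphism L -> K}).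
Implicit Types (x y z : K) (p q : {poly L}) (v : K -> int) (k m : int).

Definition ev x : {poly L} -> K := horner_morph (fun c => mulrC x (emb c)).
HB.instance Definition _ x := GRing.RMorphism.on (ev x).

Definition nonconstant x : Prop := forall c, x != emb c.

(** Linear independence over L(x): clearing denominators, the coefficients may
    be taken in L[x]. *)
Definition independent (T : finType) x (z : T -> K) : Prop :=
  forall c : T -> {poly L}, \sum_i ev x (c i) * z i = 0 -> forall i, c i = 0.

(** K has finite rank over L(x) for every nonconstant x; L being algebraically
    closed, this says that K is L or a function field of one variable. *)
Definition function_field : Prop := forall x, nonconstant x ->
  exists N, forall n (z : 'I_n -> K), independent x z -> (n <= N)%N.

Record place v : Prop := Place {
  place0 : v 0 = 0;
  placeM : forall x y, x != 0 -> y != 0 -> v (x * y) = v x + v y;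
  placeD : forall x y, x != 0 -> y != 0 -> x + y != 0 ->
    Num.min (v x) (v y) <= v (x + y);
  place_const : forall c, v (emb c) = 0;
  place_normalised : exists2 x, x != 0 & v x = 1
}.

Lemma evC x c : ev x c%:P = emb c.
Proof. exact: horner_morphC. Qed.

Lemma evX x : ev x 'X = x.
Proof. exact: horner_morphX. Qed.

Lemma evE x p : ev x p = \sum_(i < size p) emb p`_i * x ^+ i.
Proof.
rewrite /ev /horner_morph horner_coef size_map_poly.
by apply: eq_bigr => i _; rewrite coef_map.
Qed.

(** L is algebraically closed: a root of a nonzero polynomial over L lies in L,
    so a nonconstant element is transcendental. *)
Lemma ev_eq0 x p : nonconstant x -> ev x p = 0 -> p = 0.
Proof.
move=> nx; have [r ->] := closed_field_poly_normal p.
rewrite -mul_polyC rmorphM rmorph_prod /= evC => /eqP; rewrite mulf_eq0.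
case/orP => [|].
  by rewrite fmorph_eq0 => /eqP ->; rewrite mul0r.
rewrite prodf_seq_eq0 => /hasP[c _ /=].
by rewrite rmorphB /= evX evC subr_eq0 (negbTE (nx c)).
Qed.

Lemma nonconstantV x : nonconstant x -> nonconstant x^-1.
Proof.
move=> nx c; apply/eqP => h; have := nx c^-1.
by rewrite fmorphV -h invrK eqxx.
Qed.

Lemma nonconstant_neq0 x : nonconstant x -> x != 0.
Proof. by move/(_ 0); rewrite rmorph0. Qed.

(** Dividing a dependence relation over L[x] by the highest possible power of
    x makes it survive reduction modulo x. *)
Lemma primitive_relation (T : finType) x (z : T -> K) : x != 0 ->
  ~ independent x z ->
  exists2 c : T -> {poly L}, \sum_i ev x (c i) * z i = 0 & exists i, (c i)`_0 != 0.
Proof.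
move=> x0 /existsNP[c /not_implyP[hc /existsNP[i /eqP ci]]].
have [n] := ubnP (size (c i)); elim: n c hc ci => // n IH c hc ci sz.
have [h|/existsNP h] := pselect (forall j, (c j)`_0 = 0); last first.
  by exists c => //; case: h => j /eqP; exists j.
have cX j : c j = drop_poly 1 (c j) * 'X.
  rewrite -[LHS](poly_take_drop 1) [take_poly _ _]size1_polyC ?size_take_poly //.
  by rewrite coef_take_poly /= h add0r.
apply: (IH (fun j => drop_poly 1 (c j))).
- apply: (mulIf x0); rewrite mul0r -[RHS]hc mulr_suml; apply: eq_bigr => j _.
  by rewrite [in RHS]cX rmorphM /= evX mulrAC.
- by apply: contra_neq ci => h0; rewrite cX h0 mul0r.
- by rewrite size_drop_poly; move: sz ci; rewrite -size_poly_eq0; lia.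
Qed.

Section OnePlace.
Context (v : K -> int) (hv : place v).

(** The value k is reached or exceeded; the element 0, of value +oo, passes for
    every k although its recorded value is the junk value 0. *)
Definition vge k x := (x == 0) || (k <= v x).

Lemma place1 : v 1 = 0.
Proof. by rewrite -[1](rmorph1 emb) place_const. Qed.

Lemma placeV x : v x^-1 = - v x.
Proof.
have [->|x0] := eqVneq x 0; first by rewrite invr0 place0 ?oppr0.
apply/eqP; rewrite -addr_eq0 -placeM ?invr_eq0 // mulVf //.
by rewrite place1.
Qed.

Lemma place_div x y : x != 0 -> y != 0 -> v (x / y) = v x - v y.
Proof. by move=> x0 y0; rewrite placeM ?invr_eq0 // placeV. Qed.

Lemma placeN x : v (- x) = v x.
Proof.
have [->|x0] := eqVneq x 0; first by rewrite oppr0.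
rewrite -mulN1r placeM ?oppr_eq0 ?oner_eq0 //.
by rewrite -[- 1](rmorphN1 emb) place_const ?add0r.
Qed.

Lemma placeX x n : v (x ^+ n) = n%:Z * v x.
Proof.
have [->|x0] := eqVneq x 0.
  by rewrite expr0n; case: n => [|n]; rewrite ?mul0r ?place1 //= place0 ?mulr0.
elim: n => [|n IH]; first by rewrite expr0 place1 mul0r.
by rewrite exprS placeM ?expf_neq0 // IH; lia.
Qed.

Lemma vge0 k : vge k 0.
Proof. by rewrite /vge eqxx. Qed.

Lemma vge_val x : vge (v x) x.
Proof. by rewrite /vge lexx orbT. Qed.

Lemma vge_le k m x : m <= k -> vge k x -> vge m x.
Proof. by rewrite /vge => mk /orP[->//|/(le_trans mk) ->]; rewrite orbT. Qed.

Lemma vge_neq0 k x : x != 0 -> vge k x = (k <= v x).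
Proof. by rewrite /vge => /negbTE ->. Qed.

Lemma vgeN k x : vge k (- x) = vge k x.
Proof. by rewrite /vge oppr_eq0 placeN. Qed.

Lemma vgeD k x y : vge k x -> vge k y -> vge k (x + y).
Proof.
rewrite /vge; have [->|x0 /= hx] := eqVneq x 0; first by rewrite add0r.
have [->|y0 /= hy] := eqVneq y 0; first by rewrite addr0 (negbTE x0).
have [//|xy0 /=] := eqVneq (x + y) 0.
by apply: le_trans (placeD hv x0 y0 xy0); rewrite le_min hx.
Qed.

Lemma vgeB k x y : vge k x -> vge k y -> vge k (x - y).
Proof. by move=> hx hy; rewrite vgeD ?vgeN. Qed.

Lemma vge_sum k (I : Type) (r : seq I) (P : pred I) (F : I -> K) :
  (forall i, P i -> vge k (F i)) -> vge k (\sum_(i <- r | P i) F i).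
Proof. by move=> h; apply: (big_ind (vge k)) => //; [exact: vge0 | exact: vgeD]. Qed.

Lemma vgeM k m x y : vge k x -> vge m y -> vge (k + m) (x * y).
Proof.
rewrite /vge; have [->|x0 /= hx] := eqVneq x 0; first by rewrite mul0r eqxx.
have [->|y0 /= hy] := eqVneq y 0; first by rewrite mulr0 eqxx.
by rewrite placeM // lerD ?orbT.
Qed.

Lemma vgeMl k x y : vge 0 x -> vge k y -> vge k (x * y).
Proof. by move=> hx hy; rewrite -[k]add0r vgeM. Qed.

Lemma vge_const c : vge 0 (emb c).
Proof. by rewrite /vge place_const // lexx orbT. Qed.

Lemma vgeX x n : vge 0 x -> vge 0 (x ^+ n).
Proof.
move=> hx; elim: n => [|n IH]; last by rewrite exprS vgeMl.
by rewrite expr0 -(rmorph1 emb) vge_const.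
Qed.

Lemma vge_ev x p : vge 0 x -> vge 0 (ev x p).
Proof.
by move=> hx; rewrite evE vge_sum // => i _; rewrite vgeMl ?vge_const ?vgeX.
Qed.

Lemma ev_sub0 x p : ev x p - emb p`_0 = ev x (drop_poly 1 p) * x.
Proof.
rewrite -{1}[p](poly_take_drop 1) rmorphD rmorphM /= evX addrC addrA.
rewrite [take_poly _ _]size1_polyC ?size_take_poly // evC coef_take_poly /=.
by rewrite addNr add0r.
Qed.

Lemma vge_ev_sub0 k x p : 0 <= k -> vge k x -> vge k (ev x p - emb p`_0).
Proof.
move=> k0 hx; rewrite ev_sub0 vgeMl // vge_ev //; exact: vge_le hx.
Qed.

(** The strict case of the ultrametric inequality: the term of least value
    decides. *)
Lemma place_dominant x y : x != 0 -> vge (v x + 1) y ->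
  x + y != 0 /\ v (x + y) = v x.
Proof.
move=> x0 hy.
have xy0 : x + y != 0.
  apply: contraTN hy => /eqP h; have -> : y = - x by rewrite -[RHS]addr0 -h addKr.
  by rewrite vgeN vge_neq0 //; lia.
split=> //; apply/eqP; rewrite eq_le -(vge_neq0 _ xy0) vgeD ?vge_val //; last first.
  by apply: vge_le hy; lia.
rewrite andbT leNgt; apply/negP => h.
have : vge (v x + 1) (x + y - y) by rewrite vgeB // vge_neq0 //; lia.
by rewrite addrK vge_neq0 //; lia.
Qed.

Lemma nonconstant_of_value x : v x != 0 -> nonconstant x.
Proof. by move=> h c; apply: contra_neq h => ->; rewrite place_const. Qed.

Lemma uniformiser : exists t, [/\ t != 0, v t = 1 & nonconstant t].
Proof.
have [t t0 vt] := place_normalised hv; exists t; split=> //.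
by apply: nonconstant_of_value; rewrite vt.
Qed.

Lemma vge_prod_linear x (r : seq L) : vge 0 x ->
  vge 1 (\prod_(c <- r) (x - emb c)) -> exists c, vge 1 (x - emb c).
Proof.
move=> hx; elim: r => [|c r IH].
  by rewrite big_nil vge_neq0 ?oner_eq0 // place1.
rewrite big_cons; have [h _|h] := boolP (vge 1 (x - emb c)); first by exists c.
move=> hp; apply: IH; move: h hp; rewrite /vge negb_or -ltNge => /andP[x0 vx].
have [->|p0 /=] := eqVneq (\prod_(j <- r) (x - emb j)) 0; first by [].
by rewrite mulf_eq0 (negbTE x0) (negbTE p0) /= placeM //; lia.
Qed.

(** The residue field of a place is L.  With a uniformiser t, the element x
    satisfies a primitive relation over L[t]; its reduction modulo t is a
    nonzero polynomial over L of which the residue of x is a root, and that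
    polynomial splits over L. *)
Lemma residue : function_field -> forall x, vge 0 x ->
  exists c, vge 1 (x - emb c).
Proof.
move=> ff x hx; have [t [t0 vt nt]] := uniformiser; have [N hN] := ff t nt.
have [||c hc [i ci]] := @primitive_relation 'I_N.+1 t (fun i => x ^+ i) => //.
  by move=> /hN; rewrite ltnn.
pose p := \poly_(i < N.+1) (c (inord i))`_0.
have p0 : p != 0.
  apply: contra_neq ci => h; have := coef_poly N.+1 (fun i => (c (inord i))`_0) i.
  by rewrite -/p h coef0 ltn_ord inord_val => <-.
have hp : vge 1 (ev x p).
  have -> : ev x p = - \sum_i (ev t (c i) - emb (c i)`_0) * x ^+ i.
    under [in RHS]eq_bigr do rewrite mulrBl; rewrite sumrB hc add0r opprK /p poly_def.
    rewrite rmorph_sum; apply: eq_bigr => j _.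
    by rewrite /= -mul_polyC rmorphM rmorphXn /= evC evX inord_val.
  rewrite vgeN vge_sum // => j _; rewrite mulrC vgeMl ?vgeX ?vge_ev_sub0 //.
  by rewrite vge_neq0 // vt.
have [r pE] := closed_field_poly_normal p.
apply: (@vge_prod_linear x r) => //.
have l0 : emb (lead_coef p) != 0 by rewrite fmorph_eq0 lead_coef_eq0.
have -> : \prod_(c <- r) (x - emb c) = emb (lead_coef p)^-1 * ev x p.
  rewrite {2}pE -mul_polyC rmorphM /= evC fmorphV mulKf // rmorph_prod.
  by apply: eq_bigr => d _; rewrite rmorphB /= evX evC.
by rewrite vgeMl // vge_const.
Qed.

End OnePlace.

End FunctionFields.

(** * Existence of a place where a given function vanishes *)

Section ExistenceOfZeros.
Local Open Scope classical_set_scope.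
Context (L : closedFieldType) (K : fieldType) (emb : {rmorphism L -> K}).
Context (x : K) (nx : nonconstant emb x).
Implicit Types (S : set K) (a b z : K).

(** Subrings of K over L[x] in which x is not a unit. *)
Record centred_ring S : Prop := CentredRing {
  ring_const : forall c, S (emb c);
  ring_x : S x;
  ring_add : forall a b, S a -> S b -> S (a + b);
  ring_mul : forall a b, S a -> S b -> S (a * b);
  ring_nonunit : forall a, S a -> x * a != 1
}.

Lemma centred_ring_poly : centred_ring [set ev emb x p | p in [set: {poly L}]].
Proof.
split.
- by move=> c; exists c%:P => //; rewrite evC.
- by exists 'X => //; rewrite evX.
- by move=> _ _ [p _ <-] [q _ <-]; exists (p + q) => //; rewrite rmorphD.
- by move=> _ _ [p _ <-] [q _ <-]; exists (p * q) => //; rewrite rmorphM.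
- move=> _ [p _ <-]; apply/eqP => h.
  have /(ev_eq0 nx)/(congr1 (fun q : {poly L} => q`_0)) : ev emb x ('X * p - 1) = 0.
    by rewrite rmorphB rmorphM rmorph1 /= evX h subrr.
  rewrite coefB coefXM coef1 coef0 /= sub0r => /eqP.
  by rewrite oppr_eq0 oner_eq0.
Qed.

(** Zorn's lemma; the empty set is added to the rings so that the empty chain
    has an upper bound. *)
Lemma maximal_centred_ring : exists S, centred_ring S /\
  forall S', centred_ring S' -> S `<=` S' -> S' `<=` S.
Proof.
pose P S := S = set0 \/ centred_ring S.
have [F FP tot|S [PS Smax]] := @Zorn_bigcup _ P.
  have [h|] := pselect (exists2 S, F S & S !=set0); last first.
    move=> h; left; rewrite -subset0 => a [S FS Sa].
    by case: h; exists S => //; exists a.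
  have [S0 FS0 [a0 S0a]] := h; right.
  have good S : F S -> S !=set0 -> centred_ring S.
    by move=> FS [a Sa]; have [e|//] := FP _ FS; move: Sa; rewrite e.
  have good0 : centred_ring S0 by apply: good => //; exists a0.
  have two a b : (\bigcup_(X in F) X) a -> (\bigcup_(X in F) X) b ->
      exists S, [/\ F S, centred_ring S, S a & S b].
    move=> [S FS Sa] [S' FS' S'b]; have [h1|h1] := tot S S' FS FS'.
      by exists S'; split=> //; [apply: good => //; exists b | exact: h1].
    by exists S; split=> //; [apply: good => //; exists a | exact: h1].
  split.
  - by move=> c; exists S0 => //; apply: ring_const.
  - by exists S0 => //; apply: ring_x.
  - by move=> a b ha hb; have [S [FS gS Sa Sb]] := two a b ha hb; exists S => //; apply: ring_add.
  - by move=> a b ha hb; have [S [FS gS Sa Sb]] := two a b ha hb; exists S => //; apply: ring_mul.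
  - by move=> a [S FS Sa]; apply: (@ring_nonunit S) => //; apply: good => //; exists a.
have Smax' S' : centred_ring S' -> S `<=` S' -> S' `<=` S.
  move=> gS' SS'; apply: contrapT => h; apply: (Smax S'); last by right.
  by split=> // e; apply: h; rewrite e.
exists S; split=> //; case: PS => // e.
have := Smax' _ centred_ring_poly; rewrite e => /(_ (@sub0set _ _)) h.
by case: (h x); exists 'X => //; rewrite evX.
Qed.

Section Maximal.
Context (S : set K) (S_ring : centred_ring S).
Context (S_max : forall S', centred_ring S' -> S `<=` S' -> S' `<=` S).

Let Sc c : S (emb c). Proof. exact: ring_const. Qed.
Let SD a b : S a -> S b -> S (a + b). Proof. exact: ring_add. Qed.
Let SM a b : S a -> S b -> S (a * b). Proof. exact: ring_mul. Qed.
Let Sx : S x. Proof. exact: ring_x. Qed.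
Let S0 : S 0. Proof. by rewrite -(rmorph0 emb). Qed.
Let S1 : S 1. Proof. by rewrite -(rmorph1 emb). Qed.
Let SN a : S a -> S (- a).
Proof. by rewrite -mulN1r -(rmorphN1 emb) => ?; apply: SM. Qed.
Let SB a b : S a -> S b -> S (a - b). Proof. by move=> ? ?; apply: SD => //; exact: SN. Qed.
Let SX a n : S a -> S (a ^+ n).
Proof. by move=> Sa; elim: n => // n IH; rewrite exprS; exact: SM. Qed.
Let Ssum (I : Type) (r : seq I) (P : pred I) (F : I -> K) :
  (forall i, P i -> S (F i)) -> S (\sum_(i <- r | P i) F i).
Proof. by move=> h; apply: (big_ind S). Qed.
Let Sev a p : S a -> S (ev emb a p).
Proof. by move=> Sa; rewrite evE; apply: Ssum => i _; apply: SM => //; exact: SX. Qed.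

(** If u = 1 + x a, inverting u keeps x a non-unit, since every power of u is
    1 modulo x; by maximality the inverse of u was already there. *)
Lemma ring_inv_1_add a : S a -> 1 + x * a != 0 /\ S (1 + x * a)^-1.
Proof.
move=> Sa; set u := 1 + x * a; have Su : S u by apply: SD => //; exact: SM.
have u0 : u != 0.
  apply: contraNneq (ring_nonunit S_ring (SN Sa)) => h.
  have -> : x * - a = 1 - u by rewrite /u; ring.
  by rewrite h subr0.
split=> //; pose S' := [set b / u ^+ n | b in S & n in [set: nat]].
have uX n : u ^+ n != 0 by rewrite expf_neq0.
apply: (S_max (S' := S')); last by exists 1 => //; exists 1%N => //; rewrite mul1r.
  split.
  - by move=> c; exists (emb c) => //; exists 0%N => //; rewrite divr1.
  - by exists x => //; exists 0%N => //; rewrite divr1.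
  - move=> _ _ [b Sb [n _ <-]] [d Sd [m _ <-]].
    exists (b * u ^+ m + d * u ^+ n); first by apply: SD; apply: SM => //; exact: SX.
    exists (n + m)%N => //; rewrite exprD.
    by rewrite addf_div.
  - move=> _ _ [b Sb [n _ <-]] [d Sd [m _ <-]].
    exists (b * d); first exact: SM.
    by exists (n + m)%N => //; rewrite exprD invfM mulrACA.
  - move=> _ [b Sb [n _ <-]]; apply/eqP => h.
    have e : x * b = u ^+ n by rewrite -[RHS]mul1r -h mulrA divfK.
    have [d Sd hd] : exists2 d, S d & u ^+ n = 1 + x * d.
      elim: n {h e} => [|n [d Sd hd]]; first by exists 0; rewrite ?mulr0 ?addr0.
      exists (d + a + x * a * d); last by rewrite exprS hd /u; ring.
      by apply: SD; [exact: SD | apply: SM => //; exact: SM].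
    have := ring_nonunit S_ring (SB Sb Sd).
    by rewrite mulrBr e hd addrK eqxx.
by move=> b Sb; exists b => //; exists 0%N => //; rewrite divr1.
Qed.

(* S[z] is handled through the polynomials with coefficients in S *)
Let Spoly : set {poly K} := [set p | forall i, S p`_i].

(** By maximality x becomes a unit in S[z]. *)
Lemma ring_adjoin z : ~ S z -> exists2 p, Spoly p & x * p.[z] = 1.
Proof.
move=> nSz; apply: contrapT => h; apply: nSz.
apply: (S_max (S' := [set p.[z] | p in Spoly])); last first.
- by exists 'X; [move=> i; rewrite coefX; case: (i == 1)%N | rewrite hornerX].
- move=> a Sa; exists a%:P; rewrite ?hornerC // => i.
  by rewrite coefC; case: (i == 0)%N.
split.
- move=> c; exists (emb c)%:P; rewrite ?hornerC // => i.
  by rewrite coefC; case: (i == 0)%N.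
- by exists x%:P; rewrite ?hornerC // => i; rewrite coefC; case: (i == 0)%N.
- move=> _ _ [p Sp <-] [q Sq <-]; exists (p + q); rewrite ?hornerD // => i.
  by rewrite coefD; exact: SD.
- move=> _ _ [p Sp <-] [q Sq <-]; exists (p * q); rewrite ?hornerM // => i.
  by rewrite coefM; apply: Ssum => j _; exact: SM.
- by move=> _ [p Sp <-]; apply/eqP => e; apply: h; exists p.
Qed.

(** The relation x q(1/z) = 1 expresses a power of z by lower ones, because
    1 - x q(0) is invertible; substituted for the leading power of z in
    x p(z) = 1, it lowers the degree of p. *)
Lemma ring_relation_descent z (p q : {poly K}) : z != 0 -> Spoly p -> Spoly q ->
  x * p.[z] = 1 -> x * q.[z^-1] = 1 -> (size q <= size p)%N ->
  exists p', [/\ Spoly p', x * p'.[z] = 1 & (size p' < size p)%N].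
Proof.
move=> z0 Sp Sq hp hq qp.
have q0 : q != 0 by apply: contra_eq_neq hq => ->; rewrite horner0 mulr0 eq_sym oner_eq0.
have [m sq] : exists m, size q = m.+1.
  by exists (size q).-1; rewrite prednK // size_poly_gt0.
have [n sp] : exists n, size p = n.+1 by exists (size p).-1; move: qp; rewrite sq; lia.
have mn : (m <= n)%N by move: qp; rewrite sq sp.
have [u0 Su] : 1 - x * q`_0 != 0 /\ S (1 - x * q`_0)^-1.
  by rewrite -mulrN; apply: ring_inv_1_add; exact: SN.
set u := 1 - x * q`_0 in u0 Su.
pose r := \sum_(k < m) q`_k.+1 *: 'X^(n - k.+1).
have hr : z ^+ n * u = x * r.[z].
  have -> : u = x * \sum_(k < m) q`_k.+1 * z^-1 ^+ k.+1.
    rewrite /u -[X in X - _]hq horner_coef sq big_ord_recl expr0 mulr1 mulrDr.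
    by rewrite addrAC subrr add0r.
  rewrite mulrCA; congr (_ * _); rewrite mulr_sumr /r horner_sum.
  apply: eq_bigr => k _; rewrite hornerZ hornerXn mulrCA; congr (_ * _).
  rewrite exprVn; apply: (mulIf (expf_neq0 k.+1 z0)).
  by rewrite divfK ?expf_neq0 // -exprD subnK // (leq_trans (ltn_ord k)).
have szr : (size r <= n)%N.
  apply: leq_trans (size_sum _ _ _) _; apply/bigmax_leqP => k _; apply: leq_trans (size_scale_leq _ _) _.
  by rewrite size_polyXn; have := ltn_ord k; lia.
exists (take_poly n p + (p`_n * u^-1 * x) *: r); split.
- move=> i; rewrite coefD coef_take_poly coefZ; apply: SD; first by case: ifP.
  apply: SM; first by apply: SM => //; exact: SM.
  rewrite coef_sum; apply: Ssum => k _; rewrite coefZ coefXn.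
  by apply: SM => //; case: (_ == _).
- rewrite -[RHS]hp; congr (_ * _); rewrite -[in RHS](poly_take_drop n p).
  rewrite !hornerD; congr (_ + _); rewrite hornerZ -mulrA -hr.
  have -> : drop_poly n p = (p`_n)%:P.
    rewrite [drop_poly n p]size1_polyC ?coef_drop_poly //.
    by rewrite size_drop_poly sp; lia.
  by rewrite hornerM hornerC hornerXn; field.
- rewrite sp ltnS (leq_trans (size_polyD _ _)) // geq_max size_take_poly /=.
  exact: leq_trans (size_scale_leq _ _) szr.
Qed.

(** Otherwise x would be a unit both in S[z] and in S[1/z], and the descent
    could be applied for ever, alternately to z and to 1/z. *)
Lemma ring_valuative z : S z \/ S z^-1.
Proof.
apply: contrapT => /not_orP[nz nz'].
have z0 : z != 0 by apply/eqP => e; apply: nz; rewrite e.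
have [p Sp hp] := ring_adjoin nz; have [q Sq hq] := ring_adjoin nz'.
have [n] := ubnP (size p + size q).
elim: n p q Sp Sq hp hq => // n IH p q Sp Sq hp hq sz.
have [qp|pq] := leqP (size q) (size p).
  have [p' [Sp' hp' sp']] := ring_relation_descent z0 Sp Sq hp hq qp.
  by apply: (IH p' q) => //; lia.
have [||||||q' [Sq' hq' sq']] := @ring_relation_descent z^-1 q p => //.
- by rewrite invr_eq0.
- by rewrite invrK.
- exact: ltnW.
- by apply: (IH p q') => //; lia.
Qed.

Definition nonunit a := S a /\ (a = 0 \/ ~ S a^-1).

Lemma nonunitMr a b : nonunit a -> S b -> nonunit (a * b).
Proof.
move=> [Sa na] Sb; split; first exact: SM.
have [->|a0] := eqVneq a 0; first by left; rewrite mul0r.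
have [->|b0] := eqVneq b 0; first by left; rewrite mulr0.
case: na => [e|na]; first by rewrite e eqxx in a0.
right=> h; apply: na; have -> : a^-1 = b * (a * b)^-1 by rewrite invfM mulrCA divff ?mulr1.
exact: SM.
Qed.

Lemma nonunitD a b : nonunit a -> nonunit b -> nonunit (a + b).
Proof.
move=> na nb; have [->|a0] := eqVneq a 0; first by rewrite add0r.
have [->|b0] := eqVneq b 0; first by rewrite addr0.
have [h|h] := ring_valuative (a / b).
  have -> : a + b = b * (1 + a / b) by rewrite mulrDr mulr1 mulrCA divff // mulr1 addrC.
  by apply: nonunitMr => //; exact: SD.
rewrite invf_div in h; have -> : a + b = a * (1 + b / a).
  by rewrite mulrDr mulr1 mulrCA divff // mulr1.
by apply: nonunitMr => //; exact: SD.
Qed.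

Lemma nonunit_const c : nonunit (emb c) -> c = 0.
Proof.
move=> [_ [/eqP|]]; first by rewrite fmorph_eq0 => /eqP.
by rewrite -fmorphV => /(_ (Sc _)).
Qed.

Lemma nonunit_x : nonunit x.
Proof.
split=> //; right=> /(ring_nonunit S_ring).
by rewrite divff ?eqxx // (nonconstant_neq0 nx).
Qed.

Lemma nonunit_nonconstant a : a != 0 -> nonunit a -> nonconstant emb a.
Proof.
move=> a0 na c; apply: contra_neq a0 => e; move: na; rewrite e.
by move=> /nonunit_const ->; rewrite rmorph0.
Qed.

Lemma nonunit_sum (I : Type) (r : seq I) (P : pred I) (F : I -> K) :
  (forall i, P i -> nonunit (F i)) -> nonunit (\sum_(i <- r | P i) F i).
Proof.
move=> h; apply: (big_ind nonunit) => //; last exact: nonunitD.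
by split=> //; left.
Qed.

(** In a primitive relation over L[y] between the z i, divide by z j for the
    last j whose coefficient does not vanish at 0: every term but the j-th
    becomes a non-unit, and the j-th a unit. *)
Lemma divisor_chain_independent y n (z : 'I_n -> K) : y != 0 -> nonunit y ->
  (forall i, z i != 0 /\ nonunit (z i)) ->
  (forall i j : 'I_n, (i < j)%N -> nonunit (z i / z j)) -> (forall j, S (y / z j)) ->
  independent emb y z.
Proof.
move=> y0 ny hz hlt hy; have [Sy _] := ny.
apply: contrapT => /(primitive_relation y0)[c hc [i ci]].
have [j cj jmax] := @arg_maxnP _ i (fun i => (c i)`_0 != 0) (fun i => i) ci.
have [zj0 nzj] := hz j.
move/eqP: cj; apply; apply: nonunit_const.
have -> : emb (c j)`_0 = (- 1) * ((ev emb y (c j) - emb (c j)`_0) +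
   \sum_(k | k != j) ev emb y (c k) * (z k / z j)).
  have := congr1 (fun a => a / z j) hc; rewrite mul0r mulr_suml (bigD1 j) //= mulfK //.
  under eq_bigr do rewrite -mulrA.
  move=> /eqP; rewrite addr_eq0 => /eqP ->; ring.
rewrite mulrC; apply: nonunitMr; last exact: SN.
apply: nonunitD.
  by rewrite ev_sub0 mulrC; apply: nonunitMr => //; exact: Sev.
apply: nonunit_sum => k kj; have [lt|le] := ltnP k j.
  by rewrite mulrC; apply: nonunitMr; [exact: hlt | exact: Sev].
have ck : (c k)`_0 = 0.
  apply/eqP/negPn/negP => /jmax h; move/eqP: kj; apply; apply: val_inj => /=.
  by apply/eqP; rewrite eqn_leq le andbT; exact: h.
have [_ nzk] := hz k.
have -> : ev emb y (c k) = ev emb y (drop_poly 1 (c k)) * y.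
  by rewrite -ev_sub0 ck rmorph0 subr0.
have -> : ev emb y (drop_poly 1 (c k)) * y * (z k / z j) =
  z k * (ev emb y (drop_poly 1 (c k)) * (y / z j)) by ring.
by apply: nonunitMr => //; apply: SM => //; exact: Sev.
Qed.

Context (ff : function_field emb).

(** If no non-unit divided all the others, one could build from x an infinite
    sequence of proper divisors, hence arbitrarily many independent elements
    over L(x). *)
Lemma principal_nonunits : exists t, [/\ t != 0, nonunit t
  & forall a, nonunit a -> S (a / t)].
Proof.
apply: contrapT => /forallNP h.
have [t|next hnext] := @choice K K (fun t a => t != 0 -> nonunit t ->
    [/\ a != 0, nonunit a & nonunit (t / a)]).
  have [ht|ht] := pselect (t != 0 /\ nonunit t); last first.
    by exists t => t0 nt; case: ht.
  have [t0 nt] := ht; have := h t => /not_and3P[//|//|].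
  move=> /existsNP[a /not_implyP[na nS]]; exists a => _ _.
  have a0 : a != 0 by apply/eqP => e; apply: nS; rewrite e mul0r.
  have [//|St] := ring_valuative (a / t).
  rewrite invf_div in St; split=> //; split=> //; right.
  by rewrite invf_div.
have [N hN] := ff nx; pose z i := iter i next x.
have hz i : z i != 0 /\ nonunit (z i).
  elim: i => [|i [zi0 nzi]]; first by rewrite (nonconstant_neq0 nx); split=> //; exact: nonunit_x.
  by have [] := hnext _ zi0 nzi.
have hstep i : nonunit (z i / z i.+1).
  by have [zi0 nzi] := hz i; have [] := hnext _ zi0 nzi.
have hlt i j : (i < j)%N -> nonunit (z i / z j).
  elim: j => // j IH; rewrite ltnS leq_eqVlt => /predU1P[->//|/IH h1].
  have -> : z i / z j.+1 = (z i / z j) * (z j / z j.+1).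
    by rewrite mulrA divfK //; case: (hz j).
  by apply: nonunitMr => //; case: (hstep j).
suff /hN : independent emb x (fun i : 'I_N.+1 => z i) by rewrite ltnn.
apply: divisor_chain_independent => //.
- exact: nonconstant_neq0 nx.
- exact: nonunit_x.
- by move=> i j; exact: hlt.
- move=> j; case: (nat_of_ord j) => [|k]; last by case: (hlt 0%N k.+1).
  by rewrite divff // (nonconstant_neq0 nx).
Qed.

Context (t : K) (t0 : t != 0) (nt : nonunit t) (tdiv : forall a, nonunit a -> S (a / t)).

Definition unit_elt a := S a /\ S a^-1.

Lemma unit_eltM a b : unit_elt a -> unit_elt b -> unit_elt (a * b).
Proof. by move=> [? ?] [? ?]; split; rewrite ?invfM; exact: SM. Qed.

Lemma unit_eltV a : unit_elt a -> unit_elt a^-1.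
Proof. by move=> [? ?]; split; rewrite ?invrK. Qed.

(** If all powers of t divided a, they would be arbitrarily many independent
    elements over L(a). *)
Lemma finite_order a : a != 0 -> S a -> exists k : nat, unit_elt (a / t ^+ k).
Proof.
move=> a0 Sa; apply: contrapT => /forallNP h.
have hk k : S (a / t ^+ k).
  elim: k => [|k Sk]; first by rewrite divr1.
  rewrite exprSr invfM mulrA; apply: tdiv; split=> //; right=> Sk'.
  by apply: (h k).
have na : nonunit a.
  have -> : a = t * (a / t) by rewrite mulrC divfK.
  by apply: nonunitMr => //; exact: (hk 1%N).
have ntX k : nonunit (t ^+ k.+1).
  by rewrite exprS; apply: nonunitMr => //; apply: SX; case: nt.
have [N hN] := ff (nonunit_nonconstant a0 na).
suff /hN : independent emb a (fun i : 'I_N.+1 => t ^+ (N.+1 - i)) by rewrite ltnn.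
apply: divisor_chain_independent => //.
- move=> i; split; first by rewrite expf_neq0.
  by rewrite subSn -1?ltnS //; exact: ntX.
- move=> i j ij; have jN := ltn_ord j.
  have -> : (N.+1 - i = (j - i).-1.+1 + (N.+1 - j))%N by lia.
  by rewrite exprD mulfK ?expf_neq0.
Qed.

Lemma finite_orderz a : a != 0 -> exists k : int, unit_elt (a / t ^ k).
Proof.
move=> a0; have [Sa|Sa] := ring_valuative a.
  by have [k hk] := finite_order a0 Sa; exists k.
have [|k hk] := finite_order _ Sa; first by rewrite invr_eq0.
exists (- k%:Z); rewrite -invr_expz invrK.
by move/unit_eltV: hk; rewrite invfM !invrK.
Qed.

Lemma ring_expz (k : int) : S (t ^ k) -> 0 <= k.
Proof.
move=> Sk; rewrite leNgt; apply/negP => k0.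
have [St [/eqP|]] := nt; first by rewrite (negbTE t0).
apply; have -> : t^-1 = t ^+ `|k|.-1 * t ^ k.
  rewrite -[t ^+ _]/(t ^ (`|k|.-1)%:Z) -expfzDr //.
  by rewrite -[t^-1]/(t ^ (- 1)); congr (t ^ _); lia.
by apply: SM => //; exact: SX.
Qed.

Lemma unit_expz (k : int) : unit_elt (t ^ k) -> k = 0.
Proof.
by move=> [/ring_expz h1]; rewrite invr_expz => /ring_expz h2; lia.
Qed.

(** The value of a is the k for which a / t ^ k is a unit. *)
Lemma place_of_maximal_ring : exists2 v, place emb v & 0 < v x.
Proof.
have [a|v hv] := @choice K int (fun a k => if a == 0 then k = 0 else unit_elt (a / t ^ k)).
  by case: (eqVneq a 0) => [_|a0]; [exists 0 | exact: finite_orderz].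
have v0 : v 0 = 0 by have := hv 0; rewrite eqxx.
have {}hv a : a != 0 -> unit_elt (a / t ^ v a) by move=> a0; have := hv a; rewrite (negbTE a0).
have tX k : t ^ k != 0 by rewrite expfz_neq0.
have v_uniq a k : a != 0 -> unit_elt (a / t ^ k) -> v a = k.
  move=> a0 ha; apply/eqP; rewrite -subr_eq0; apply/eqP/unit_expz.
  have := unit_eltM ha (unit_eltV (hv a a0)); rewrite invf_div mulrC mulrA divfK //.
  by rewrite expfzDr // -invr_expz.
have Sv a : a != 0 -> S a -> 0 <= v a.
  move=> a0 Sa; apply: ring_expz; have [_] := hv a a0; rewrite invf_div => h.
  by have := SM Sa h; rewrite mulrCA divff // mulr1.
have vS a : a != 0 -> 0 <= v a -> S a.
  move=> a0; have [h _] := hv a a0; case: (v a) h => // n h _.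
  by have := SM h (SX n nt.1); rewrite divfK ?expf_neq0.
have vM a b : a != 0 -> b != 0 -> v (a * b) = v a + v b.
  move=> a0 b0; apply: v_uniq; first by rewrite mulf_neq0.
  by rewrite expfzDr // invfM mulrACA; apply: unit_eltM; exact: hv.
have vV a : a != 0 -> v a^-1 = - v a.
  move=> a0; apply: v_uniq; first by rewrite invr_eq0.
  by rewrite -invr_expz -invfM; apply: unit_eltV; exact: hv.
have vD a b : a != 0 -> b != 0 -> a + b != 0 -> v a <= v b -> v a <= v (a + b).
  move=> a0 b0 ab0 le.
  have e : a + b = a * (1 + b / a) by rewrite mulrDr mulr1 mulrCA divff // mulr1.
  have ne : 1 + b / a != 0 by apply: contraNneq ab0 => h; rewrite e h mulr0.
  rewrite e vM // lerDl; apply: Sv => //; apply: SD => //; apply: vS.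
    by rewrite mulf_neq0 ?invr_eq0.
  by rewrite vM ?invr_eq0 // vV // subr_ge0.
exists v; last first.
  have x0 := nonconstant_neq0 nx.
  rewrite lt0r Sv // andbT; apply/negP => /eqP h.
  have := hv x x0; rewrite h divr1 => -[_ Sx'].
  by have := ring_nonunit S_ring Sx'; rewrite divff ?eqxx.
split=> //.
- move=> a b a0 b0 ab0; have [le|lt] := leP (v a) (v b); first exact: vD.
  by rewrite addrC; apply: vD; rewrite // 1?addrC // ltW.
- move=> c; have [->|c0] := eqVneq c 0; first by rewrite rmorph0.
  by apply: v_uniq; rewrite ?fmorph_eq0 // divr1; split=> //; rewrite -fmorphV.
- by exists t => //; apply: v_uniq => //; rewrite divff //; split; rewrite ?invr1.
Qed.

End Maximal.

Theorem exists_zero : function_field emb -> exists2 v, place emb v & 0 < v x.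
Proof.
move=> ff; have [S [S_ring S_max]] := maximal_centred_ring.
have [t [t0 nt tdiv]] := principal_nonunits S_ring S_max ff.
exact: place_of_maximal_ring S_ring S_max ff t t0 nt tdiv.
Qed.

End ExistenceOfZeros.

(** * The degree of a principal divisor *)

Section Divisors.
Context (L : closedFieldType) (K : fieldType) (emb : {rmorphism L -> K}).
Context (ff : function_field emb).
Context (B : choiceType) (v : B -> K -> int).
Context (v_place : forall b, place emb (v b)).
Context (v_inj : forall b b', v b =1 v b' -> b = b').
Context (has_zero : forall x, nonconstant emb x -> exists b, 0 < v b x).
Implicit Types (b : B) (s : seq B) (x y z : K).

Lemma placeXz b x (k : int) : v b (x ^ k) = k * v b x.
Proof.
case: k => n; first exact: (placeX (v_place b)).
rewrite NegzE -exprnN (placeV (v_place b)) (placeX (v_place b)); lia.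
Qed.

(** An inclusion of valuation rings sends units to units, so the second
    valuation is a multiple of the first, hence equal to it as both are
    normalised. *)
Lemma val_ring_separation b b' : b != b' ->
  exists y, [/\ y != 0, 0 <= v b y & v b' y < 0].
Proof.
move=> /eqP bb'; apply: contrapT => h; apply: bb'; apply: v_inj => y.
have {}h z : z != 0 -> 0 <= v b z -> 0 <= v b' z.
  by move=> z0 vz; rewrite leNgt; apply/negP => vz'; apply: h; exists z.
have [t [t0 vt _]] := uniformiser (v_place b).
have vE z : z != 0 -> v b' z = v b z * v b' t.
  move=> z0; set k := v b z.
  have u0 : z * t ^ (- k) != 0 by rewrite mulf_neq0 ?expfz_neq0.
  have vu : v b (z * t ^ (- k)) = 0.
    by rewrite (placeM (v_place b)) ?expfz_neq0 // placeXz vt mulr1 subrr.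
  have h1 := h _ u0; have h2 := h (z * t ^ (- k))^-1.
  have e : v b' (z * t ^ (- k)) = v b' z - k * v b' t.
    by rewrite (placeM (v_place b')) ?expfz_neq0 // placeXz mulNr.
  move: h1 h2; rewrite invr_eq0 !(placeV (v_place _)) vu e u0; lia.
have vt' : v b' t = 1.
  have [t' t'0 e] := place_normalised (v_place b').
  have /(congr1 absz)/esym/eqP := vE t' t'0; rewrite e abszM muln_eq1 => /andP[_].
  by have := h t t0; rewrite vt; lia.
have [->|y0] := eqVneq y 0; first by rewrite !(place0 (v_place _)).
by rewrite vE // vt' mulr1.
Qed.

Lemma place_add_neq b x y : x != 0 -> y != 0 -> v b x != v b y ->
  x + y != 0 /\ v b (x + y) = Num.min (v b x) (v b y).
Proof.
move=> x0 y0; case: ltgtP => // h _.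
  by apply: (place_dominant (v_place b)) => //; rewrite vge_neq0 //; lia.
by rewrite addrC; apply: (place_dominant (v_place b)) => //; rewrite vge_neq0 //; lia.
Qed.

(** Weak approximation, by induction on s.  If w works for s but has no pole at
    the new place b1, add a high power of an element with a zero at b and a
    pole at b1; the power is taken so large that no value can cancel. *)
Lemma zero_elsewhere_pole b s : b \notin s ->
  exists w, [/\ w != 0, 0 < v b w & forall b', b' \in s -> v b' w < 0].
Proof.
elim: s => [_|b1 s IH].
  by have [t [t0 vt _]] := uniformiser (v_place b); exists t; rewrite vt.
rewrite inE negb_or => /andP[bb1 /IH [y [y0 by0 sy]]].
have [y1|y1] := ltP (v b1 y) 0.
  by exists y; split=> // b'; rewrite inE => /predU1P[->|/sy].
have [z1 [z10 bz1 b1z1]] := val_ring_separation bb1.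
have [z2 [z20 b1z2 bz2]] : exists z, [/\ z != 0, 0 <= v b1 z & v b z < 0].
  by apply: val_ring_separation; rewrite eq_sym.
pose z := z1 / z2; have z0 : z != 0 by rewrite mulf_neq0 ?invr_eq0.
have bz : 0 < v b z by rewrite (place_div (v_place b)) //; lia.
have b1z : v b1 z < 0 by rewrite (place_div (v_place b1)) //; lia.
pose m := (\max_(b' <- s) `|v b' y|).+1%N; have zm0 : z ^+ m != 0 by rewrite expf_neq0.
have vzm b' : v b' (z ^+ m) = m%:Z * v b' z by rewrite (placeX (v_place b')).
have [w0 b1w] : y + z ^+ m != 0 /\ v b1 (y + z ^+ m) < 0.
  have [|w0 e] := @place_add_neq b1 y (z ^+ m) y0 zm0; first by rewrite vzm; nia.
  by split=> //; rewrite e vzm gt_min; apply/orP; right; nia.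
exists (y + z ^+ m); split=> //.
  suff: vge (v b) 1 (y + z ^+ m) by rewrite vge_neq0 //; lia.
  by rewrite (vgeD (v_place b)) // vge_neq0 //= ?vzm; nia.
move=> b'; rewrite inE => /predU1P[->//|b's].
have hm : (`|v b' y| < m)%N by rewrite ltnS (leq_bigmax_seq b').
have yneg := sy b' b's.
have [|_ ->] := @place_add_neq b' y (z ^+ m) y0 zm0.
  rewrite vzm; apply: contraTneq hm => e; rewrite e abszM -leqNgt leq_pmulr //.
  by rewrite absz_gt0; apply: contraTneq yneg => z'; rewrite e z' mulr0.
by rewrite gt_min yneg.
Qed.

(** If w has a zero at b and poles on s, then 1 / (1 + w) has the value 1 at b and
    zeros on s. *)
Lemma unit_elsewhere_zero b s : b \notin s ->
  exists u, [/\ u != 0, v b u = 0 & forall b', b' \in s -> 0 < v b' u].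
Proof.
move=> /zero_elsewhere_pole[w [w0 bw sw]].
have [w1 vw1] : 1 + w != 0 /\ v b (1 + w) = v b 1.
  apply: (place_dominant (v_place b)); rewrite ?oner_eq0 //.
  by rewrite vge_neq0 // (place1 (v_place b)); lia.
exists (1 + w)^-1; rewrite invr_eq0 w1 (placeV (v_place b)) vw1.
rewrite (place1 (v_place b)) oppr0; split=> // b' /sw hb'.
rewrite (placeV (v_place b')) addrC oppr_gt0.
have [|_ ->//] := place_dominant (v_place b') w0 (y := 1).
by rewrite vge_neq0 ?oner_eq0 // (place1 (v_place b')); lia.
Qed.

(** Independence is checked place by place: in a primitive relation choose, at
    a place where some coefficient survives modulo x, a surviving term of least
    order alpha; every other term has a larger value there. *)
Lemma jets_independent (T : finType) x (beta : T -> B) (alpha : T -> nat)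
    (w : T -> K) :
  injective (fun i => (beta i, alpha i)) ->
  (forall i, (alpha i)%:Z < v (beta i) x) ->
  (forall i, w i != 0 /\ v (beta i) (w i) = alpha i) ->
  (forall i j, beta j != beta i -> vge (v (beta i)) (v (beta i) x) (w j)) ->
  independent emb x w.
Proof.
move=> inj ax hw hoff.
have [i0 _|e] := pickP (@predT T); last by move=> c _ i; have := e i.
have x0 : x != 0.
  by apply: contraTneq (ax i0) => ->; rewrite (place0 (v_place _)); lia.
apply: contrapT => /(primitive_relation x0)[c hc [i1 ci1]].
pose P i := (beta i == beta i1) && ((c i)`_0 != 0).
have [|i /andP[/eqP bi ci] imin] := @arg_minnP _ i1 P alpha.
  by rewrite /P eqxx.
rewrite /P -bi {P bi ci1} in imin; set b := beta i in imin.
have hv := v_place b; have bx : (alpha i)%:Z < v b x := ax i.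
have vx : vge (v b) (v b x) x := vge_val _ _.
have [wi0 vwi] := hw i.
have [ei0 vei] : ev emb x (c i) != 0 /\ v b (ev emb x (c i)) = 0.
  have := place_dominant hv (x := emb (c i)`_0) (y := ev emb x (c i) - emb (c i)`_0).
  rewrite [emb _ + _]addrC subrK (place_const hv); apply; first by rewrite fmorph_eq0.
  by apply: vge_le (vge_ev_sub0 hv _ _ vx); lia.
move: hc; rewrite (bigD1 i) //=.
have := place_dominant hv (x := ev emb x (c i) * w i)
  (y := \sum_(j | j != i) ev emb x (c j) * w j).
rewrite mulf_neq0 // => /(_ isT) h hc; move: h; rewrite hc eqxx => h.
suff /h[] : vge (v b) (v b (ev emb x (c i) * w i) + 1)
  (\sum_(j | j != i) ev emb x (c j) * w j) by [].
rewrite (placeM hv) // vei add0r vwi (vge_sum hv) // => j ji.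
have ex : vge (v b) 0 (ev emb x (c j)) by apply: (vge_ev hv); apply: vge_le vx; lia.
have [bj|bj] := eqVneq (beta j) b; last first.
  by apply: (vgeMl hv) => //; apply: vge_le (hoff i j bj); rewrite -/b; lia.
have [wj0 vwj] := hw j; rewrite bj in vwj.
have [aij|aij] := ltnP (alpha i) (alpha j).
  by apply: (vgeMl hv) => //; rewrite vge_neq0 // vwj; lia.
have aji : alpha j != alpha i.
  by apply: contra_neq ji => e; apply: inj; rewrite bj e.
have cj : (c j)`_0 = 0.
  apply/eqP; apply: contraTT aij => cj; rewrite -ltnNge ltn_neqAle eq_sym aji.
  by apply: imin; rewrite bj eqxx.
rewrite -[ev emb x (c j)]subr0 -[X in _ - X](rmorph0 emb) -cj.
apply: (@vge_le _ _ (v b x + alpha j)); first lia.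
by apply: (vgeM hv) => //; [apply: (vge_ev_sub0 hv) => //; lia | rewrite vge_neq0 // vwj].
Qed.

(** Each zero b of order e contributes e elements, of orders 0, ..., e - 1 at b
    and vanishing at the other zeros to at least the order of x. *)
Lemma zeros_independent x s : uniq s -> (forall b, b \in s -> 0 < v b x) ->
  exists z : 'I_(\sum_(b <- s) `|v b x|)%N -> K, independent emb x z.
Proof.
move=> us hs; pose I := [seq (b, a) | b <- s, a <- iota 0 `|v b x|%N].
have szI : (\sum_(b <- s) `|v b x|)%N = size I.
  rewrite size_allpairs_dep sumnE big_map; apply: eq_bigr => b _.
  by rewrite size_iota.
rewrite szI.
have uI : uniq I.
  apply: allpairs_uniq_dep => //; first by move=> b _; exact: iota_uniq.
  by move=> [b a] [b' a'] _ _ [-> ->].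
have mI i : ((tnth (in_tuple I) i).1 \in s) /\
    ((tnth (in_tuple I) i).2%:Z < v (tnth (in_tuple I) i).1 x).
  have /allpairsPdep[b [a [bs]]] := mem_tnth i (in_tuple I).
  by rewrite mem_iota => h ->; split=> //=; move: (hs b bs) h; lia.
have hw (i : 'I_(size I)) : exists w, [/\ w != 0,
    v (tnth (in_tuple I) i).1 w = (tnth (in_tuple I) i).2
    & forall b', b' \in s -> b' != (tnth (in_tuple I) i).1 -> v b' x <= v b' w].
  have [] := mI i; case: (tnth _ i) => b a /= bs ab.
  have [t [t0 vt _]] := uniformiser (v_place b).
  have [|u [u0 vu su]] := @unit_elsewhere_zero b (rem b s).
    by rewrite mem_rem_uniq // inE eqxx.
  (* a power of u large enough to outweigh the possible poles of t ^ a *)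
  pose M := (\max_(b' <- s) `|(v b' x - a%:Z * v b' t)%R|)%N.
  exists (t ^+ a * u ^+ M); rewrite mulf_neq0 ?expf_neq0 //; split=> //.
    by rewrite (placeM (v_place b)) ?expf_neq0 // !(placeX (v_place b)) vt vu; lia.
  move=> b' b's bb'; have := su b'; rewrite mem_rem_uniq // inE bb' => /(_ b's) ub'.
  rewrite (placeM (v_place b')) ?expf_neq0 // !(placeX (v_place b')).
  have : (`|(v b' x - a%:Z * v b' t)%R| <= M)%N.
    by rewrite (leq_bigmax_seq b').
  by move: (v b' x) (a%:Z * v b' t) => p q; nia.
have [w ww] := choice hw.
exists w; apply: (@jets_independent _ x (fun i => (tnth (in_tuple I) i).1)
   (fun i => (tnth (in_tuple I) i).2)).
- move=> i j; rewrite -!surjective_pairing; exact: (tuple_uniqP (in_tuple I) uI).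
- by move=> i; case: (mI i).
- by move=> i; case: (ww i).
- move=> i j ne; have [wj0 _ h] := ww j; rewrite vge_neq0 // h //.
    by case: (mI i).
  by rewrite eq_sym.
Qed.

Lemma finite_zeros x : nonconstant emb x ->
  exists2 s, uniq s & forall b, (b \in s) = (0 < v b x).
Proof.
move=> nx; have [N hN] := ff nx.
pose P k := `[< exists s, [/\ uniq s, (forall b, b \in s -> 0 < v b x) & size s = k] >].
have exP : exists k, P k by exists 0%N; apply/asboolP; exists [::].
have bP k : P k -> (k <= N)%N.
  move=> /asboolP[s [us hs <-]].
  have [z /hN] := zeros_independent us hs; apply: leq_trans.
  rewrite -sum1_size big_seq [X in (_ <= X)%N]big_seq; apply: leq_sum => b /hs; lia.
have [k /asboolP[s [us hs sk]] kmax] := ex_maxnP exP bP.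
exists s => // b; apply/idP/idP => [/hs//|bx]; apply/negPn/negP => bs.
suff /kmax : P k.+1 by rewrite ltnn.
apply/asboolP; exists (b :: s); rewrite /= bs us sk; split=> // b'.
by rewrite inE => /predU1P[->|/hs].
Qed.

Lemma regular_const x : (forall b, vge (v b) 0 x) -> exists c, x = emb c.
Proof.
move=> hx; apply: contrapT => /forallNP h.
have nx : nonconstant emb x by move=> c; apply/eqP; exact: h.
have [b] := has_zero (nonconstantV nx).
rewrite (placeV (v_place b)); have := hx b; rewrite vge_neq0 ?(nonconstant_neq0 nx) //.
lia.
Qed.

(** The Riemann-Roch space L(D) of the effective divisor listed, with
    repetitions, by D. *)
Definition in_RR (D : seq B) x : Prop :=
  forall b, vge (v b) (- (count_mem b D)%:Z) x.

Definition const_independent (T : finType) (z : T -> K) : Prop :=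
  forall c : T -> L, \sum_i emb (c i) * z i = 0 -> forall i, c i = 0.

(** Adding a place to D adds at most one dimension: an element of the larger
    space has a leading coefficient at that place, by [residue], and those for
    which it is zero are in the smaller space.  The induction starts from
    L(0) = L. *)
Lemma RR_dim D n (z : 'I_n -> K) : (forall i, in_RR D (z i)) ->
  const_independent z -> (n <= (size D).+1)%N.
Proof.
elim: D n z => [|b D IH] n z zD zind.
  case: n z zD zind => [//|[//|n]] z zD zind.
  have [i|c hc] := @choice _ _ (fun i c => z i = emb c).
    by apply: regular_const => b; have := zD i b.
  pose i0 : 'I_n.+2 := ord0; pose i1 : 'I_n.+2 := fintype.lift ord0 ord0.
  have ne : i1 != i0 by [].
  have h (i : 'I_n.+2) (d : 'I_n.+2 -> L) :
      \sum_j d j * c j = 0 -> d i = 0.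
    move=> e; apply: zind; transitivity (emb (\sum_j d j * c j)).
      by rewrite rmorph_sum; apply: eq_bigr => j _; rewrite hc rmorphM.
    by rewrite e rmorph0.
  have c1 : c i1 = 0.
    have := h i0 (fun j => if j == i0 then c i1 else if j == i1 then - c i0 else 0).
    rewrite eqxx; apply; rewrite (bigD1 i0) // (bigD1 i1) //= ?eqxx ?(negbTE ne).
    rewrite big1 ?addr0; first by ring.
    by move=> j /andP[/negbTE -> /negbTE ->]; rewrite mul0r.
  have := h i1 (fun j => (j == i1)%:R); rewrite eqxx => h1.
  suff /eqP : (1 : L) = 0 by rewrite oner_eq0.
  apply: h1.
  rewrite (bigD1 i1) //= c1 mulr0 add0r big1 // => j /negbTE ->; exact: mul0r.
have hv := v_place b; have [t [t0 vt _]] := uniformiser hv.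
pose m := (count_mem b D).+1; have tm0 : t ^+ m != 0 by rewrite expf_neq0.
have vtm : v b (t ^+ m) = m by rewrite (placeX hv) vt mulr1.
have [i|c hc] := @choice _ _ (fun i c => vge (v b) 1 (z i * t ^+ m - emb c)).
  apply: (residue hv ff); rewrite -[0](addNr m%:Z) (vgeM hv) //; last first.
    by rewrite vge_neq0 // vtm.
  by have := zD i b; rewrite /= eqxx.
(* once the leading coefficient at b is killed, the pole divisor drops to D *)
have drop x : in_RR (b :: D) x -> vge (v b) 1 (x * t ^+ m) -> in_RR D x.
  move=> xD h b'; have := xD b'; rewrite /=.
  have [<-|] := eqVneq b b'; last by rewrite add0n.
  move=> _; have [->|x0] := eqVneq x 0; first exact: vge0.
  move: h; rewrite !vge_neq0 ?mulf_neq0 // (placeM hv) // vtm /m.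
  by move: (v b x) (count_mem b D) => p q; lia.
have [c0|/existsNP[i0 /eqP ci0]] := pselect (forall i, c i = 0).
  apply: (@leq_trans (size D).+1) => //=; apply: IH zind => i; apply: drop => //.
  by have := hc i; rewrite c0 rmorph0 subr0.
case: n i0 z zD zind c hc ci0 => [[]//|n] i0 z zD zind c hc ci0.
(* otherwise z i0 is used to kill the leading coefficients of the others *)
rewrite /= ltnS; pose r (j : 'I_n) := c (fintype.lift i0 j) / c i0.
apply: (IH n (fun j : 'I_n => z (fintype.lift i0 j) - emb (r j) * z i0)) => [j|d hd].
  apply: drop => [b'|].
    have hv' := v_place b'; apply: (vgeB hv'); first exact: zD.
    by apply: (vgeMl hv'); [exact: (vge_const hv') | exact: zD].
  have -> : (z (fintype.lift i0 j) - emb (r j) * z i0) * t ^+ m =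
    (z (fintype.lift i0 j) * t ^+ m - emb (c (fintype.lift i0 j))) -
    emb (r j) * (z i0 * t ^+ m - emb (c i0)).
    by rewrite mulrBr -rmorphM /r divfK // mulrBl; ring.
  by rewrite (vgeB hv) // (vgeMl hv) // (vge_const hv).
pose e (i : 'I_n.+1) := if unlift i0 i is Some j then d j else - \sum_j d j * r j.
move=> j; have := zind e; rewrite (bigD1_ord i0) //= {1}/e unlift_none.
have eK k : e (fintype.lift i0 k) = d k by rewrite /e liftK.
move=> /(_ _ (fintype.lift i0 j)); rewrite eK; apply.
under eq_bigr do rewrite eK.
rewrite -[RHS]hd rmorphN rmorph_sum mulNr mulr_suml addrC -sumrB.
by apply: eq_bigr => k _; rewrite mulrBr rmorphM mulrA.
Qed.

Lemma list_of_multiplicities s (f : B -> nat) : exists2 D : seq B,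
  size D = (\sum_(b <- s) f b)%N & forall b, b \in s -> (f b <= count_mem b D)%N.
Proof.
elim: s => [|b s [D sD hD]]; first by exists [::]; rewrite ?big_nil.
exists (nseq (f b) b ++ D); first by rewrite size_cat size_nseq big_cons sD.
move=> b'; rewrite inE count_cat count_nseq /= => /predU1P[->|/hD h].
  by rewrite eqxx mul1n leq_addr.
exact: leq_trans h (leq_addl _ _).
Qed.

(** Multiplying by the leading coefficient of an equation over L[x] makes an
    element integral over L[x], hence without poles where x has none. *)
Lemma integral_multiple x y : nonconstant emb x ->
  exists2 q : {poly L}, q != 0 & forall b, 0 <= v b x -> vge (v b) 0 (ev emb x q * y).
Proof.
move=> nx; have [->|y0] := eqVneq y 0.
  by exists 1 => [|b _]; rewrite ?oner_eq0 // mulr0 vge0.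
have [N hN] := ff nx.
have [c hc [i ci]] : exists2 c : 'I_N.+1 -> {poly L},
    \sum_i ev emb x (c i) * y ^+ i = 0 & exists i, c i != 0.
  apply: contrapT => h.
  suff /hN : independent emb x (fun i : 'I_N.+1 => y ^+ i) by rewrite ltnn.
  move=> c hc i; apply/eqP/negPn/negP => ci; apply: h; exists c => //.
  by exists i.
have [d cd dmax] := @arg_maxnP _ i (fun i => c i != 0) (fun i => i) ci.
exists (c d) => // b bx; have hv := v_place b.
have bx' : vge (v b) 0 x by rewrite vge_neq0 // (nonconstant_neq0 nx).
have qe p : vge (v b) 0 (ev emb x p) by exact: (vge_ev hv).
have q0 : ev emb x (c d) != 0.
  by apply: contra_neq cd; exact: (ev_eq0 nx).
rewrite vge_neq0 ?mulf_neq0 // (placeM hv) // leNgt; apply/negP => neg.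
have vq : 0 <= v b (ev emb x (c d)) by have := qe (c d); rewrite vge_neq0.
move: hc; rewrite (bigD1 d) //=.
have := place_dominant hv (x := ev emb x (c d) * y ^+ d)
  (y := \sum_(j | j != d) ev emb x (c j) * y ^+ j).
rewrite mulf_neq0 ?expf_neq0 // => /(_ isT) h hc; move: h; rewrite hc eqxx => h.
suff /h[] : vge (v b) (v b (ev emb x (c d) * y ^+ d) + 1)
  (\sum_(j | j != d) ev emb x (c j) * y ^+ j) by [].
rewrite (placeM hv) ?expf_neq0 // (placeX hv) (vge_sum hv) // => j jd.
have [->|cj] := eqVneq (c j) 0; first by rewrite rmorph0 mul0r vge0.
have jd' : (j < d)%N by rewrite ltn_neqAle jd; exact: dmax.
apply: (vgeMl hv) => //; rewrite vge_neq0 ?expf_neq0 // (placeX hv); nia.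
Qed.

(** The products w_i x^k for k <= l, where w_i runs over n independent elements
    without poles outside s', are independent over L and lie in the space of a
    divisor of degree M #|s'| + l deg (x)_oo; the bound on its dimension for
    l > M #|s'| forces n <= deg (x)_oo. *)
Lemma sum_pole_orders_ge x s s' : nonconstant emb x ->
  uniq s -> (forall b, b \in s -> 0 < v b x) ->
  (forall b, (b \in s') = (v b x < 0)) ->
  (\sum_(b <- s) `|v b x| <= \sum_(b <- s') `|v b x|)%N.
Proof.
move=> nx us hs hs'; have [w wind] := zeros_independent us hs.
move: w wind; set n := (\sum_(b <- s) _)%N => w wind.
set delta := (\sum_(b <- s') _)%N.
have [i|q hq] := @choice _ _ (fun (i : 'I_n) (q : {poly L}) => q != 0 /\
   forall b, 0 <= v b x -> vge (v b) 0 (ev emb x q * w i)).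
  by have [q q0 h] := integral_multiple (w i) nx; exists q.
pose y i := ev emb x (q i) * w i.
pose M := (\max_(b <- s') \max_i `|v b (y i)|)%N.
have count l : (n * l.+1 <= (\sum_(b <- s') (M + l * `|v b x|)%N).+1)%N.
  have [D <- hD] := list_of_multiplicities s' (fun b => M + l * `|v b x|)%N.
  pose z (k : 'I_n * 'I_l.+1) := y k.1 * x ^+ k.2.
  have cT : #|{: 'I_n * 'I_l.+1}| = (n * l.+1)%N by rewrite card_prod !card_ord.
  rewrite -cT; apply: (@RR_dim D _ (fun j => z (enum_val j))) => [j b|c hc j].
    case: (enum_val j) => i k; rewrite /z /=; have hv := v_place b.
    have [bx|bx] := leP 0 (v b x).
      apply: (@vge_le _ _ 0); first lia.
      apply: (vgeMl hv); first by case: (hq i) => _; apply.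
      by rewrite (vgeX hv) // vge_neq0 // (nonconstant_neq0 nx).
    have bs' : b \in s' by rewrite hs'.
    have := hD b bs'; have yM : (`|v b (y i)| <= M)%N.
      apply: leq_trans (leq_bigmax_seq b bs' isT).
      exact: (leq_bigmax i).
    have kl : (k <= l)%N by rewrite -ltnS.
    move=> hD'; apply: (@vge_le _ _ (v b (y i) + v b (x ^+ k))).
      have kl' : (k * `|v b x| <= l * `|v b x|)%N by rewrite leq_mul2r kl orbT.
      have -> : v b (x ^+ k) = - (k * `|v b x|)%N%:Z.
        by rewrite (placeX hv) PoszM ltz0_abs // mulrN opprK.
      move: yM hD' kl'; move: (M) (k * _)%N (l * _)%N (v b (y i)) (count_mem b D).
      by move=> *; lia.
    by apply: (vgeM hv); exact: vge_val.
  pose c' i k := c (enum_rank (i, k)).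
  pose P i := \sum_(k < l.+1) c' i k *: 'X^k.
  have : \sum_i ev emb x (q i * P i) * w i = 0.
    rewrite -[RHS]hc (reindex (@enum_rank _)) /=; last first.
      by apply: onW_bij; exact: enum_rank_bij.
    rewrite (eq_bigr (fun k => emb (c' k.1 k.2) * z k)); last first.
      by case=> i k _; rewrite enum_rankK.
    rewrite -(pair_bigA _ (fun i k => emb (c' i k) * z (i, k))) /=.
    apply: eq_bigr => i _; rewrite rmorphM /P rmorph_sum mulr_sumr mulr_suml.
    apply: eq_bigr => k _; rewrite /z /y /= -mul_polyC rmorphM rmorphXn /= evC evX.
    by ring.
  move=> /wind/(_ (enum_val j).1)/eqP; rewrite mulf_eq0.
  case: (hq (enum_val j).1) => /negbTE -> _ /= /eqP/(congr1 (fun p : {poly L} => p`_(enum_val j).2)).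
  rewrite coef0 /P coef_sum (bigD1 (enum_val j).2) //= big1 => [|k ne]; last first.
    by rewrite coefZ coefXn eq_sym (inj_eq val_inj) (negbTE ne) mulr0.
  by rewrite addr0 coefZ coefXn eqxx mulr1 /c' -surjective_pairing enum_valK.
have {}count l : (n * l.+1 <= (size s' * M + l * delta).+1)%N.
  have := count l; rewrite big_split /= -big_distrr /= big_const_seq.
  by rewrite count_predT iter_addn_0 [(M * _)%N]mulnC.
(* this l exceeds the part of the degree that does not depend on l *)
have := count (size s' * M)%N.+1; nia.
Qed.

(** The inequality between the numbers of zeros and of poles, applied to x and
    to 1/x. *)
Theorem principal_degree x : x != 0 ->
  exists s, [/\ uniq s, forall b, v b x != 0 -> b \in s & \sum_(b <- s) v b x = 0].
Proof.
move=> x0; have [[c ->]|/forallNP h] := pselect (exists c, x = emb c).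
  exists [::]; rewrite big_nil; split=> // b.
  by rewrite (place_const (v_place b)) eqxx.
have nx : nonconstant emb x by move=> c; apply/eqP; exact: h.
have [s us hs] := finite_zeros nx.
have [s' us' hs'] := finite_zeros (nonconstantV nx).
have {}hs' b : (b \in s') = (v b x < 0).
  by rewrite hs' (placeV (v_place b)) oppr_gt0.
have le1 : (\sum_(b <- s) `|v b x| <= \sum_(b <- s') `|v b x|)%N.
  by apply: sum_pole_orders_ge => // b; rewrite hs.
have le2 : (\sum_(b <- s') `|v b x| <= \sum_(b <- s) `|v b x|)%N.
  have absV b : `|v b x|%N = `|v b x^-1|%N by rewrite (placeV (v_place b)) abszN.
  under eq_bigr do rewrite absV; under [leqRHS]eq_bigr do rewrite absV.
  apply: sum_pole_orders_ge => //; first exact: nonconstantV.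
    by move=> b; rewrite hs' (placeV (v_place b)); lia.
  by move=> b; rewrite hs (placeV (v_place b)); lia.
have pos : \sum_(b <- s) v b x = (\sum_(b <- s) `|v b x|)%N%:Z.
  rewrite -natz natr_sum !big_seq; apply: eq_bigr => b; rewrite hs natz; lia.
have neg : \sum_(b <- s') v b x = - (\sum_(b <- s') `|v b x|)%N%:Z.
  rewrite -natz natr_sum -sumrN !big_seq; apply: eq_bigr => b; rewrite hs' natz; lia.
exists (s ++ s'); split.
- rewrite cat_uniq us us' andbT; apply/hasPn => b; rewrite hs' hs; lia.
- by move=> b; rewrite mem_cat hs hs'; lia.
- by rewrite big_cat /= pos neg; lia.
Qed.
End Divisors.

(** * Rational functions and their values at points *)

(** Gaussian elimination of one column at a time, without division. *)
Lemma left_kernel (R : idomainType) N n (p : 'I_n -> 'I_N -> R) : (N < n)%N ->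
  exists u : 'I_n -> R, (exists i, u i != 0) /\ forall j, \sum_i u i * p i j = 0.
Proof.
elim: N n p => [|N IH] n p Nn.
  exists (fun=> 1); split; last by case.
  by exists (Ordinal Nn); rewrite oner_eq0.
have [h|/existsNP[i0 /eqP pi0]] := pselect (forall i, p i ord0 = 0).
  have [|u [u0 hu]] := IH n (fun i j => p i (fintype.lift ord0 j)); first exact: ltnW.
  exists u; split=> // j; case: (unliftP ord0 j) => [k ->//|->].
  by apply: big1 => i _; rewrite h mulr0.
case: n i0 p pi0 Nn => [[]//|n] i0 p pi0 Nn.
have [//|u [[k uk] hu]] := IH n (fun i j => p i0 ord0 * p (fintype.lift i0 i) (fintype.lift ord0 j)
  - p (fintype.lift i0 i) ord0 * p i0 (fintype.lift ord0 j)).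
pose u' i := if unlift i0 i is Some k then u k * p i0 ord0
  else - \sum_k u k * p (fintype.lift i0 k) ord0.
have u'0 : u' i0 = - \sum_k u k * p (fintype.lift i0 k) ord0 by rewrite /u' unlift_none.
have u'l i : u' (fintype.lift i0 i) = u i * p i0 ord0 by rewrite /u' liftK.
exists u'; split; first by exists (fintype.lift i0 k); rewrite u'l mulf_neq0.
move=> j; rewrite (bigD1_ord i0) //= u'0.
under eq_bigr do rewrite u'l.
case: (unliftP ord0 j) => [j' ->|->]; last first.
  rewrite mulNr mulr_suml addrC -sumrB big1 // => i _; by ring.
rewrite -[RHS](hu j') mulNr mulr_suml addrC -sumrB.
by apply: eq_bigr => i _; ring.
Qed.

(** Two ways to specialise functions to constants are used: the value at a
    point and the residue at a branch.  Both are relations compatible with the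
    ring operations, which is all that is needed to specialise polynomials. *)
Section RingRelation.
Context (L : closedFieldType) (K : fieldType) (emb : {rmorphism L -> K}).
Context (V : K -> L -> Prop).
Context (Vconst : forall c, V (emb c) c).
Context (VD : forall a b c d, V a c -> V b d -> V (a + b) (c + d)).
Context (VM : forall a b c d, V a c -> V b d -> V (a * b) (c * d)).

Lemma relationX a c n : V a c -> V (a ^+ n) (c ^+ n).
Proof.
move=> h; elim: n => [|n IH]; last by rewrite !exprS; exact: VM.
by rewrite !expr0 -[X in V X _](rmorph1 emb).
Qed.

Lemma relation_sum (I : Type) (r : seq I) (F : I -> K) (G : I -> L) :
  (forall i, V (F i) (G i)) -> V (\sum_(i <- r) F i) (\sum_(i <- r) G i).
Proof.
move=> h; apply: big_ind2 => // [|*]; last exact: VD.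
by rewrite -[X in V X _](rmorph0 emb).
Qed.

Lemma relation_prod (I : Type) (r : seq I) (F : I -> K) (G : I -> L) :
  (forall i, V (F i) (G i)) -> V (\prod_(i <- r) F i) (\prod_(i <- r) G i).
Proof.
move=> h; apply: big_ind2 => // [|*]; last exact: VM.
by rewrite -[X in V X _](rmorph1 emb).
Qed.

Lemma relation_ev a c (p : {poly L}) : V a c -> V (ev emb a p) p.[c].
Proof.
move=> h; rewrite evE horner_coef; apply: relation_sum => i.
by apply: VM => //; exact: relationX.
Qed.

Lemma relation_mmap n (y : 'I_n -> K) (p : 'I_n -> L) (a : {mpoly L[n]}) :
  (forall j, V (y j) (p j)) -> V (mmap emb y a) a.@[p].
Proof.
move=> h; rewrite mevalE /mmap; apply: relation_sum => m.
by apply: VM => //; apply: relation_prod => i; exact: relationX.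
Qed.

End RingRelation.

Section RationalFunctions.
Context (L : closedFieldType) (w : nat) (X : variety L w).
Implicit Types (a b : {mpoly L[w.+1]}) (f : funfield X) (p : hcoord L w).

Lemma ff_scalar_zmod : zmod_morphism (ff_scalar X).
Proof.
move=> c d; have -> : ff_scalar X c - ff_scalar X d =
  \pi_(funfield X) (quot_add (quot_scalar X c) (quot_opp (quot_scalar X d))).
  by rewrite -(ff_addE (quot_scalar X c)) -ff_oppE.
by apply/pi_funfieldP => x _ /=; rewrite !(mevalC, meval1, mevalD, mevalN, mevalM); ring.
Qed.

Lemma ff_scalar_monoid : monoid_morphism (ff_scalar X).
Proof.
split=> // c d; have -> : ff_scalar X c * ff_scalar X d =
  \pi_(funfield X) (quot_mul (quot_scalar X c) (quot_scalar X d)) by exact: ff_mulE.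
by apply/pi_funfieldP => x _ /=; rewrite !(mevalC, meval1, mevalD, mevalN, mevalM); ring.
Qed.

HB.instance Definition _ :=
  GRing.isZmodMorphism.Build L (funfield X) (ff_scalar X) ff_scalar_zmod.
HB.instance Definition _ :=
  GRing.isMonoidMorphism.Build L (funfield X) (ff_scalar X) ff_scalar_monoid.

Lemma admissibleM a b a' b' : admissible X a b -> admissible X a' b' ->
  admissible X (a * a') (b * b').
Proof. by move=> h h'; exact: (admissible_mul (Quot h) (Quot h')). Qed.

Lemma admissibleX a b n : admissible X a b -> admissible X (a ^+ n) (b ^+ n).
Proof.
move=> h; elim: n => [|n IH]; last by rewrite !exprS; exact: admissibleM.
by rewrite !expr0; exact: (admissible_scalar X 1).
Qed.

Lemma ratfun_eq a b a' b' : admissible X a b -> admissible X a' b' ->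
  ratfun X a b = ratfun X a' b' <->
  forall x, vpts X x -> a.@[x] * b'.@[x] = a'.@[x] * b.@[x].
Proof. by move=> h h'; rewrite (ratfunE h) (ratfunE h') pi_funfieldP. Qed.

Lemma ratfun_eq0 a b : admissible X a b -> ratfun X a b = 0 <-> vanishes_on X a.
Proof. by move=> h; rewrite (ratfunE h) pi_eq0. Qed.

Lemma ratfun_const c : ff_scalar X c = ratfun X c%:MP 1.
Proof. by rewrite (ratfunE (admissible_scalar X c)). Qed.

Lemma ratfunM a b a' b' : admissible X a b -> admissible X a' b' ->
  ratfun X a b * ratfun X a' b' = ratfun X (a * a') (b * b').
Proof.
move=> h h'; rewrite (ratfunE (admissibleM h h')) (ratfunE h) (ratfunE h').
by rewrite [LHS]ff_mulE; apply/pi_funfieldP.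
Qed.

Lemma ratfunD a b a' b' : admissible X a b -> admissible X a' b' ->
  ratfun X a b + ratfun X a' b' = ratfun X (a * b' + a' * b) (b * b').
Proof.
move=> h h'; have h2 : admissible X (a * b' + a' * b) (b * b').
  exact: (admissible_add (Quot h) (Quot h')).
rewrite (ratfunE h2) (ratfunE h) (ratfunE h').
by rewrite [LHS]ff_addE; apply/pi_funfieldP.
Qed.

Lemma ratfunX a b n : admissible X a b -> ratfun X a b ^+ n = ratfun X (a ^+ n) (b ^+ n).
Proof.
move=> h; elim: n => [|n IH].
  by rewrite !expr0 -[LHS](rmorph1 (ff_scalar X)) /= ratfun_const mpolyC1.
by rewrite !exprS IH ratfunM //; exact: admissibleX.
Qed.

Lemma ratfun_repr f : exists a b, admissible X a b /\ f = ratfun X a b.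
Proof.
elim/quotW: f => q; exists (qnum q), (qden q); have h := Defs.quotP q; split=> //.
by rewrite (ratfunE h); apply/pi_funfieldP.
Qed.

Lemma ratfun_div a b c : admissible X a c -> admissible X b c -> ~ vanishes_on X b ->
  ratfun X a c / ratfun X b c = ratfun X a b.
Proof.
move=> [[d [ha hc]] nc] [[d' [hb hc']] _] nb.
have c0 : c != 0 by apply/eqP => e; apply: nc; rewrite e => x _; rewrite meval0.
have e : d = d' := dhomog_uniq c0 hc hc'; subst d'.
have h1 : admissible X a b by split=> //; exists d.
have h2 : admissible X b c by split=> //; exists d.
have h3 : admissible X a c by split=> //; exists d.
have b0 : ratfun X b c != 0 by apply/eqP => /(ratfun_eq0 h2).
apply: (mulIf b0); rewrite divfK // ratfunM //.
apply/ratfun_eq => //; first exact: admissibleM.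
by move=> x _; rewrite !mevalM; ring.
Qed.

Definition has_value p f c : Prop := exists a b,
  [/\ admissible X a b, b.@[p] != 0, a.@[p] = c * b.@[p] & f = ratfun X a b].

Lemma has_value_const p c : has_value p (ff_scalar X c) c.
Proof.
exists c%:MP, 1; rewrite mevalC meval1 mulr1 oner_eq0 ratfun_const; split=> //.
exact: admissible_scalar.
Qed.

Lemma has_valueD p f f' c c' : has_value p f c -> has_value p f' c' ->
  has_value p (f + f') (c + c').
Proof.
move=> [a [b [h b0 e ->]]] [a' [b' [h' b0' e' ->]]].
exists (a * b' + a' * b), (b * b'); rewrite mevalD !mevalM e e' mulf_neq0 //.
split=> //; [exact: (admissible_add (Quot h) (Quot h')) | by ring | exact: ratfunD].
Qed.

Lemma has_valueM p f f' c c' : has_value p f c -> has_value p f' c' ->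
  has_value p (f * f') (c * c').
Proof.
move=> [a [b [h b0 e ->]]] [a' [b' [h' b0' e' ->]]].
exists (a * a'), (b * b'); rewrite !mevalM e e' mulf_neq0 //.
split=> //; [exact: admissibleM | by ring | exact: ratfunM].
Qed.

Lemma has_value_uniq p f c c' : vpts X p -> has_value p f c -> has_value p f c' ->
  c = c'.
Proof.
move=> Xp [a [b [h b0 e ->]]] [a' [b' [h' b0' e']]].
move=> /(ratfun_eq h h')/(_ p Xp); rewrite e e' => h1.
by apply: (mulIf (mulf_neq0 b0 b0')); rewrite mulrA h1; ring.
Qed.

(** Identities between rational functions can be tested on the values they take
    at the points off a hypersurface. *)
Lemma ff_eq0_away f d b : b \is d.-homog -> ~ vanishes_on X b ->
  (forall p, vpts X p -> b.@[p] != 0 -> has_value p f 0) -> f = 0.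
Proof.
move=> hb nb h; have [a' [b' [h' fE]]] := ratfun_repr f; rewrite {}fE in h *.
have [[d' [ha' hb']] _] := h'.
apply/(ratfun_eq0 h')/(vanishes_on_away ha' hb nb) => p Xp /(h p Xp).
move=> [a [b1 [h1 b0 a0 e]]]; have := proj1 (ratfun_eq h' h1) e p Xp.
by rewrite a0 !mul0r => /eqP; rewrite mulf_eq0 (negbTE b0) orbF => /eqP.
Qed.

Lemma coord_nonvanishing p i : vpts X p -> p i != 0 -> ~ vanishes_on X 'X_i.
Proof. by move=> Xp pi /(_ p Xp)/eqP; rewrite mevalXU (negbTE pi). Qed.

Lemma exists_coord : exists i, ~ vanishes_on X 'X_i.
Proof.
have [[p Xp] _] := vpts_irreducible X; have [i pi] := variety_is_point Xp.
by exists i; exact: coord_nonvanishing pi.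
Qed.

End RationalFunctions.

(** * The function field of a curve is finite over L(x) *)

Section Chart.
Context (L : closedFieldType) (w : nat) (X : variety L w) (i0 : 'I_w.+1).
Context (nv : ~ vanishes_on X 'X_i0).
Implicit Types (a b : {mpoly L[w.+1]}) (p : hcoord L w).

Definition coord (j : 'I_w.+1) : funfield X := ratfun X 'X_j 'X_i0.

Lemma coord_homog (j : 'I_w.+1) : ('X_j : {mpoly L[w.+1]}) \is 1.-homog.
Proof. by rewrite dhomogX; apply/eqP; exact: mdeg1. Qed.

Lemma coordX_homog (j : 'I_w.+1) d : ('X_j ^+ d : {mpoly L[w.+1]}) \is d.-homog.
Proof. by have := dhomogMn d (coord_homog j); rewrite mul1n. Qed.

Lemma admissible_linear (l l' : {mpoly L[w.+1]}) : l \is 1.-homog -> l' \is 1.-homog ->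
  ~ vanishes_on X l' -> admissible X l l'.
Proof. by move=> h h' n; split=> //; exists 1%N. Qed.

Lemma admissible_coord j : admissible X 'X_j 'X_i0.
Proof. by apply: admissible_linear => //; exact: coord_homog. Qed.

Lemma nonvanishingX (l : {mpoly L[w.+1]}) d : l \is 1.-homog -> ~ vanishes_on X l ->
  ~ vanishes_on X (l ^+ d).
Proof.
move=> hl nl; elim: d => [|d IH].
  have [[x Xx] _] := vpts_irreducible X.
  by move=> /(_ x Xx)/eqP; rewrite expr0 meval1 oner_eq0.
have hd : l ^+ d \is d.-homog by have := dhomogMn d hl; rewrite mul1n.
by rewrite exprS => /(vanishes_onM hl hd) [].
Qed.

Lemma admissible_form a d : a \is d.-homog -> admissible X a ('X_i0 ^+ d).
Proof.
move=> ha; split; first by exists d; split=> //; exact: coordX_homog.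
by apply: nonvanishingX => //; exact: coord_homog.
Qed.

Lemma has_value_ratfun p a b : admissible X a b -> b.@[p] != 0 ->
  has_value p (ratfun X a b) (a.@[p] / b.@[p]).
Proof. by move=> h b0; exists a, b; rewrite divfK. Qed.

Lemma has_value_coord p j : p i0 != 0 -> has_value p (coord j) (p j / p i0).
Proof.
move=> pi; have := @has_value_ratfun p 'X_j 'X_i0 (admissible_coord j).
by rewrite !mevalXU; apply.
Qed.

Lemma has_value_mmap p a : p i0 != 0 ->
  has_value p (mmap (ff_scalar X) coord a) a.@[fun j => p j / p i0].
Proof.
move=> pi; apply: relation_mmap; [exact: has_value_const | | | ].
- by move=> *; exact: has_valueD.
- by move=> *; exact: has_valueM.
- by move=> j; exact: has_value_coord.
Qed.

Lemma meval_dehomog p a d : a \is d.-homog -> p i0 != 0 ->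
  a.@[fun j => p j / p i0] = a.@[p] / p i0 ^+ d.
Proof.
move=> ha pi; rewrite (meval_homogZ (c := (p i0)^-1) (x := p) ha).
  by rewrite exprVn mulrC.
by move=> j; rewrite mulrC.
Qed.

(** Dehomogenisation: the rational function a / x_i0^d is the polynomial a in the
    affine coordinates x_j / x_i0. *)
Lemma mmap_coord a d : a \is d.-homog ->
  mmap (ff_scalar X) coord a = ratfun X a ('X_i0 ^+ d).
Proof.
move=> ha; apply/eqP; rewrite -subr_eq0; apply/eqP.
apply: (ff_eq0_away (coord_homog i0) nv) => p Xp; rewrite mevalXU => pi.
have h1 := has_value_mmap a pi.
have h2 : has_value p (ratfun X a ('X_i0 ^+ d)) (a.@[p] / p i0 ^+ d).
  have := @has_value_ratfun p a ('X_i0 ^+ d) (admissible_form ha).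
  by rewrite rmorphXn /= mevalXU; apply; rewrite expf_neq0.
have := has_valueD h1 (has_valueM (has_value_const X p (-1)) h2).
by rewrite rmorphN1 !mulN1r (meval_dehomog ha pi) subrr.
Qed.

Lemma ratfun_mmap a b : admissible X a b ->
  ratfun X a b = mmap (ff_scalar X) coord a / mmap (ff_scalar X) coord b.
Proof.
move=> h; have [[d [ha hb]] nb] := h; rewrite (mmap_coord ha) (mmap_coord hb).
by rewrite ratfun_div //; exact: admissible_form.
Qed.

Lemma mmap_coord_neq0 a d : a \is d.-homog -> ~ vanishes_on X a ->
  mmap (ff_scalar X) coord a != 0.
Proof.
by move=> ha na; rewrite (mmap_coord ha); apply/eqP => /(ratfun_eq0 (admissible_form ha)).
Qed.

End Chart.

Section Finiteness.
Context (L : closedFieldType) (w : nat) (C : curve L w).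
Local Notation emb := (ff_scalar C : {rmorphism L -> funfield C}).
Local Notation evx := (ev emb).

(** The dimension of C being 1, x and y are algebraically dependent; the relation
    is read as a polynomial in y with coefficients in L[x]. *)
Lemma power_relation x y : exists D, ~ independent emb x (fun k : 'I_D => y ^+ k).
Proof.
have [_ /(_ (fun i : 'I_2 => if i == ord0 then x else y))] := curve_dim1 C.
move=> /existsNP[P /not_implyP[hP /eqP P0]].
exists (msize P) => ind.
pose Q (k : 'I_(msize P)) := \sum_(m <- msupp P | m 1 == k) P@_m *: 'X^(m 0).
have hm m : m \in msupp P -> (m 1%R < msize P)%N.
  move=> /msize_mdeg_lt; apply: leq_ltn_trans.
  by rewrite mdegE (bigD1 1%R) //= leq_addr.
have hQ : \sum_k evx x (Q k) * y ^+ k = 0.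
  rewrite -[RHS]hP /mmap.
  transitivity (\sum_(k < msize P) \sum_(m <- msupp P | m 1 == k)
      ff_scalar C P@_m * mmap1 (fun i : 'I_2 => if i == ord0 then x else y) m).
    apply: eq_bigr => k _; rewrite rmorph_sum mulr_suml.
    apply: eq_bigr => m /eqP mk.
    rewrite -mul_polyC rmorphM rmorphXn /= evC evX /mmap1 !big_ord_recl big_ord0.
    by rewrite mulr1 /= -mk mulrA; congr (_ * _ ^+ m _ * _ ^+ m _); apply: val_inj.
  rewrite (exchange_big_dep xpredT) //= !big_seq; apply: eq_bigr => m mP.
  by rewrite (big_pred1 (Ordinal (hm m mP))) // => k; rewrite eq_sym -val_eqE.
have [m mP] : exists m, m \in msupp P.
  by case E: (msupp P) => [|m r]; [move/eqP: E; rewrite msupp_eq0 (negbTE P0)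
    | exists m; rewrite inE eqxx].
have /(congr1 (fun q : {poly L} => q`_(m 0))) := ind Q hQ (Ordinal (hm m mP)).
rewrite coef0 coef_sum big_mkcond (bigD1_seq m) //= eqxx big1 => [|m' ne].
  by rewrite addr0 coefZ coefXn eqxx mulr1 => /eqP; rewrite mcoeff_eq0 mP.
case: eqP => // e; rewrite coefZ coefXn; case: eqP => [e0|]; last by rewrite mulr0.
case/eqP: ne; apply/mnmP => i; case: (unliftP ord0 i) => [j|] ->; last exact: esym e0.
by rewrite (ord1 j) (_ : fintype.lift _ _ = 1%R) //; exact: val_inj.
Qed.

Lemma leading_relation x y : exists d (c : nat -> {poly L}),
  c d != 0 /\ evx x (c d) * y ^+ d = - \sum_(k < d) evx x (c k) * y ^+ k.
Proof.
have [D /existsNP[c /not_implyP[hc /existsNP[i /eqP ci]]]] := power_relation x y.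
have [d cd dmax] := @arg_maxnP _ i (fun i => c i != 0) (fun i => i) ci.
pose c' k := if insub k is Some i then c i else 0.
have c'E (k : 'I_D) : c' k = c k by rewrite /c' valK.
exists d, c'; rewrite c'E; split=> //; apply/eqP; rewrite -addr_eq0; apply/eqP.
transitivity (\sum_(k < d.+1) evx x (c' k) * y ^+ k).
  by rewrite big_ord_recr /= c'E addrC.
rewrite -[RHS]hc.
rewrite (big_ord_widen_cond D xpredT (fun k => evx x (c' k) * y ^+ k)) //=.
rewrite big_mkcond; apply: eq_bigr => k _; rewrite c'E; case: ifPn => //.
rewrite -leqNgt => dk; have [->|ck] := eqVneq (c k) 0; first by rewrite rmorph0 mul0r.
by have kd : (k <= d)%N := dmax k ck; rewrite leqNgt dk in kd.
Qed.

Section Span.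
Context (n : nat) (y : 'I_n -> funfield C) (x : funfield C) (D : nat).
Context (nx : nonconstant emb x).
Context (y_relation : forall j, exists c : nat -> {poly L},
  c D.+1 != 0 /\ evx x (c D.+1) * y j ^+ D.+1 = - \sum_(k < D.+1) evx x (c k) * y j ^+ k).

Definition monomial (alpha : {ffun 'I_n -> 'I_D.+1}) : funfield C :=
  \prod_j y j ^+ alpha j.

(** The L(x)-span of the monomials; s is a common denominator. *)
Definition spanned z : Prop := exists s (p : {ffun 'I_n -> 'I_D.+1} -> {poly L}),
  s != 0 /\ evx x s * z = \sum_alpha evx x (p alpha) * monomial alpha.

Lemma spanned0 : spanned 0.
Proof.
exists 1, (fun=> 0); rewrite oner_eq0 mulr0 big1 // => alpha _.
by rewrite rmorph0 mul0r.
Qed.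

Lemma spannedD z z' : spanned z -> spanned z' -> spanned (z + z').
Proof.
move=> [s [p [s0 h]]] [s' [p' [s'0 h']]].
exists (s * s'), (fun a => s' * p a + s * p' a); rewrite mulf_neq0 //; split=> //.
have -> : evx x (s * s') * (z + z') = evx x s' * (evx x s * z) + evx x s * (evx x s' * z').
  by rewrite rmorphM /=; ring.
rewrite h h' !mulr_sumr -big_split; apply: eq_bigr => a _ /=.
by rewrite rmorphD !rmorphM /=; ring.
Qed.

Lemma spannedZ q z : spanned z -> spanned (evx x q * z).
Proof.
move=> [s [p [s0 h]]]; exists s, (fun a => q * p a); split=> //.
by rewrite mulrCA h mulr_sumr; apply: eq_bigr => a _; rewrite rmorphM mulrA.
Qed.

Lemma spannedZV q z : q != 0 -> spanned (evx x q * z) -> spanned z.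
Proof.
move=> q0 [s [p [s0 h]]]; exists (s * q), p; rewrite mulf_neq0 //; split=> //.
by rewrite -h rmorphM mulrA.
Qed.

Lemma spanned_sum (I : Type) (r : seq I) (F : I -> funfield C) :
  (forall i, spanned (F i)) -> spanned (\sum_(i <- r) F i).
Proof.
by move=> h; apply: big_ind => //; [exact: spanned0 | exact: spannedD].
Qed.

Lemma spanned_monomial alpha : spanned (monomial alpha).
Proof.
exists 1, (fun b => (b == alpha)%:R); rewrite oner_eq0; split=> //.
rewrite (bigD1 alpha) //= eqxx big1 ?addr0 // => b /negbTE ->.
by rewrite rmorph0 mul0r.
Qed.

(** When the exponent of y j would exceed the bound, the relation for y j
    rewrites its power by lower ones. *)
Lemma spannedMy j z : spanned z -> spanned (y j * z).
Proof.
move=> [s [p [s0 h]]]; apply: (spannedZV s0); rewrite mulrCA h mulr_sumr.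
apply: spanned_sum => a; rewrite mulrCA; apply: spannedZ => {p s s0 z h}.
pose upd k := [ffun i => if i == j then k else a i].
have updE k : monomial (upd k) = y j ^+ k * \prod_(i | i != j) y i ^+ a i.
  rewrite /monomial (bigD1 j) //= ffunE eqxx; congr (_ * _).
  by apply: eq_bigr => i /negbTE h; rewrite ffunE h.
have -> : monomial a = monomial (upd (a j)).
  by congr monomial; apply/ffunP => i; rewrite ffunE; case: eqP => // ->.
rewrite updE mulrA -exprS; have [lt|ge] := ltnP (a j).+1 D.+1.
  by have := spanned_monomial (upd (Ordinal lt)); rewrite updE.
have -> : (a j).+1 = D.+1 by apply/eqP; rewrite eqn_leq ge andbT ltn_ord.
have [c [cD e]] := y_relation j; apply: (spannedZV cD).
rewrite mulrA e mulNr -mulN1r -(rmorphN1 emb) -(evC emb x) mulr_suml.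
apply: spannedZ; apply: spanned_sum => k; rewrite -mulrA -updE.
by apply: spannedZ; exact: spanned_monomial.
Qed.

Lemma spanned_mmap a : spanned (mmap emb y a).
Proof.
rewrite /mmap; apply: spanned_sum => m; rewrite -(evC emb x); apply: spannedZ.
suff h : forall u, spanned u -> spanned (mmap1 y m * u).
  rewrite -[mmap1 y m]mulr1; apply: h.
  have := spanned_monomial [ffun=> ord0]; congr spanned.
  by apply: big1 => j _; rewrite ffunE expr0.
rewrite /mmap1; elim/big_ind: _ => [u|z z' hz hz' u hu|j _ u hu].
- by rewrite mul1r.
- by rewrite -mulrA; apply/hz/hz'.
- elim: (m j) => [|k IH]; first by rewrite expr0 mul1r.
  by rewrite exprS -mulrA; exact: spannedMy.
Qed.

End Span.

Lemma raise_relation x y d (c : nat -> {poly L}) e : (d <= e)%N -> c d != 0 ->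
  evx x (c d) * y ^+ d = - \sum_(k < d) evx x (c k) * y ^+ k ->
  exists c' : nat -> {poly L}, c' e != 0 /\
    evx x (c' e) * y ^+ e = - \sum_(k < e) evx x (c' k) * y ^+ k.
Proof.
elim: e => [|e IH] de cd h; first by move: de cd h; rewrite leqn0 => /eqP ->; exists c.
have [lt|ge] := ltnP e d.
  by have -> : e.+1 = d by [apply/eqP; rewrite eqn_leq lt de]; exists c.
have [c' [c'e h']] := IH ge cd h.
exists (fun k => if k is k'.+1 then c' k' else 0); split=> //.
rewrite big_ord_recl rmorph0 mul0r add0r exprS mulrCA h' mulrN mulr_sumr.
by congr (- _); apply: eq_bigr => k _; rewrite /= exprS mulrCA.
Qed.

(** The coordinates y j generate K, and are algebraic over L(x), so the finitely
    many monomials with bounded exponents span all polynomials in y over L(x).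
    Elements of K get into this span once multiplied by a common denominator B,
    and more elements than monomials are dependent. *)
Theorem funfield_finite : function_field emb.
Proof.
move=> x nx; have [i0 nv] := exists_coord C; pose y := coord C i0.
have [j|d hd] := @choice _ _ (fun j (d : nat) => exists c : nat -> {poly L},
    c d != 0 /\ evx x (c d) * y j ^+ d = - \sum_(k < d) evx x (c k) * y j ^+ k).
  by have [d [c hc]] := leading_relation x (y j); exists d, c.
pose D := (\max_j d j)%N.
have y_rel j : exists c : nat -> {poly L}, c D.+1 != 0 /\
    evx x (c D.+1) * y j ^+ D.+1 = - \sum_(k < D.+1) evx x (c k) * y j ^+ k.
  have [c [c0 hc]] := hd j; apply: (raise_relation _ c0 hc).
  by apply: leqW; exact: (leq_bigmax j).
pose T : finType := {ffun 'I_w.+1 -> 'I_D.+1}.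
exists #|T| => n z zind.
have [k|ab hab] := @choice _ _ (fun k (ab : {mpoly L[w.+1]} * {mpoly L[w.+1]}) =>
    admissible C ab.1 ab.2 /\ z k = ratfun C ab.1 ab.2).
  by have [a [b [h ->]]] := ratfun_repr (z k); exists (a, b).
pose B := \prod_k (ab k).2.
have b0 k : mmap emb y (ab k).2 != 0.
  by have [[[d' [_ hb]] nb] _] := hab k; exact: mmap_coord_neq0 hb nb.
have B0 : mmap emb y B != 0 by rewrite rmorph_prod; apply/prodf_neq0 => k _; exact: b0.
have span k : spanned y x D (z k * mmap emb y B).
  have [h ->] := hab k; rewrite (ratfun_mmap nv h) /B (bigD1 k) //=.
  rewrite rmorphM /= mulrA divfK; last exact: b0.
  by rewrite -rmorphM; apply: spanned_mmap.
have [s hs] := choice span; have [p hp] := choice hs.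
rewrite leqNgt; apply/negP => /(@left_kernel {poly L} _ _ (fun k t => p k (enum_val t))).
move=> [u [[k uk] hu]].
have /zind/(_ k)/eqP : \sum_k evx x (u k * s k) * z k = 0.
  apply: (mulIf B0); rewrite mul0r mulr_suml.
  transitivity (\sum_k \sum_alpha evx x (u k * p k alpha) * monomial y alpha).
    apply: eq_bigr => l _; have [_ e] := hp l.
    rewrite -mulrA rmorphM -mulrA /= [evx x (s l) * _]e mulr_sumr.
    by apply: eq_bigr => alpha _; rewrite rmorphM mulrA.
  rewrite exchange_big big1 //= => alpha _; rewrite -mulr_suml -rmorph_sum /=.
  by have := hu (enum_rank alpha); rewrite enum_rankK => ->; rewrite rmorph0 mul0r.
by have [s0 _] := hp k; rewrite mulf_eq0 (negbTE uk) (negbTE s0).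
Qed.

End Finiteness.

(** * Centres of branches and zeros of forms *)

Section Branches.
Context (L : closedFieldType) (w : nat) (C : curve L w).
Local Notation emb := (ff_scalar C : {rmorphism L -> funfield C}).
Implicit Types (g : branch C) (f : funfield C) (p : hcoord L w).
Implicit Types (a b l : {mpoly L[w.+1]}).

Lemma branch_place g : place emb (bval g).
Proof.
split; [exact: bval0 | exact: bvalM | exact: bvalD | exact: bval_scalar |].
exact: bval_normalised.
Qed.

Lemma branch_ext g g' : bval g =1 bval g' -> g = g'.
Proof.
case: g g' => v h1 h2 h3 h4 h5 [v' k1 k2 k3 k4 k5] /= /funext e.
by subst v'; congr Branch; exact: Prop_irrelevance.
Qed.

Lemma branch_has_zero f : nonconstant emb f -> exists g, 0 < bval g f.
Proof.
move=> nf; have [v [h1 h2 h3 h4 h5] vf] := exists_zero nf (funfield_finite (C := C)).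
by exists (Branch h1 h2 h3 h4 h5).
Qed.

Lemma wset_of_fun (F : branch C -> int) (s : seq (branch C)) : uniq s ->
  (forall g, F g != 0 -> g \in s) ->
  exists W : wset C, (forall g, coeff g W = F g) /\ deg W = \sum_(g <- s) F g.
Proof.
move=> us hs; exists (\sum_(g <- s) << F g *g g >>); split; last first.
  by rewrite raddf_sum; apply: eq_bigr => g _; exact: degU.
move=> g; rewrite raddf_sum /=; under eq_bigr do rewrite coeffU.
have [gs|gs] := boolP (g \in s).
  rewrite (bigD1_seq g) //= eqxx mulr1 big1 ?addr0 // => g' /negbTE ->.
  by rewrite mulr0.
rewrite big_seq big1 => [|g' g's]; last first.
  by case: eqP => [e|_]; [move: gs; rewrite -e g's | rewrite mulr0].
by apply/esym/eqP; apply: contraNT gs; exact: hs.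
Qed.

Lemma principal_divisor f : f != 0 ->
  exists W : wset C, (forall g, coeff g W = bval g f) /\ deg W = 0.
Proof.
move=> f0; have [s [us hs <-]] := principal_degree (funfield_finite (C := C))
  branch_place branch_ext branch_has_zero f0.
exact: (@wset_of_fun (fun g => bval g f) s us hs).
Qed.

Section Residues.
Context (g : branch C).

Definition has_residue f (c : L) : Prop := vge (bval g) 1 (f - ff_scalar C c).

Lemma has_residue_const c : has_residue (ff_scalar C c) c.
Proof. by rewrite /has_residue subrr vge0. Qed.

Lemma has_residue_vge f c : has_residue f c -> vge (bval g) 0 f.
Proof.
move=> h; rewrite -[f](subrK (ff_scalar C c)).
apply: (vgeD (branch_place g)); last exact: (vge_const (branch_place g)).
by apply: vge_le h.
Qed.

Lemma has_residueD f f' c c' : has_residue f c -> has_residue f' c' ->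
  has_residue (f + f') (c + c').
Proof.
rewrite /has_residue rmorphD => h h'; rewrite opprD addrACA.
exact: (vgeD (branch_place g)).
Qed.

Lemma has_residueM f f' c c' : has_residue f c -> has_residue f' c' ->
  has_residue (f * f') (c * c').
Proof.
move=> h h'; rewrite /has_residue rmorphM /=.
have -> : f * f' - ff_scalar C c * ff_scalar C c' =
  f * (f' - ff_scalar C c') + ff_scalar C c' * (f - ff_scalar C c) by ring.
apply: (vgeD (branch_place g)); apply: (vgeMl (branch_place g)) => //.
  exact: has_residue_vge h.
exact: (vge_const (branch_place g)).
Qed.

Lemma has_residue_uniq f c c' : has_residue f c -> has_residue f c' -> c = c'.
Proof.
move=> h h'; have := vgeB (branch_place g) h' h.
have -> : f - ff_scalar C c' - (f - ff_scalar C c) = emb (c - c').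
  by rewrite rmorphB /=; ring.
rewrite /vge bval_scalar orbF fmorph_eq0 subr_eq0 => /eqP //.
Qed.

Lemma has_residue_mmap n (y : 'I_n -> funfield C) (q : 'I_n -> L) (a : {mpoly L[n]}) :
  (forall j, has_residue (y j) (q j)) -> has_residue (mmap emb y a) a.@[q].
Proof.
move=> h; apply: (relation_mmap (V := has_residue)) => //.
- exact: has_residue_const.
- by move=> *; exact: has_residueD.
- by move=> *; exact: has_residueM.
Qed.

(** Take the coordinate of least order at g as denominator. *)
Lemma branch_chart : exists i, ~ vanishes_on C 'X_i /\
  forall j, vge (bval g) 0 (coord C i j).
Proof.
have [i0 nv] := exists_coord C.
pose P i := `[< ~ vanishes_on C 'X_i >].
have Pi0 : P i0 by exact/asboolP.
have [i [/asboolP ni imin]] : exists i, P i /\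
    forall j, P j -> bval g (coord C i0 i) <= bval g (coord C i0 j).
  have h := @arg_minP _ _ _ i0 P (fun i => bval g (coord C i0 i)) Pi0.
  by case: h => i Pi imin; exists i.
exists i; split=> // j.
have [vj|/asboolP nj] := pselect (vanishes_on C 'X_j).
  by rewrite /coord (proj2 (ratfun_eq0 (admissible_coord ni j)) vj) vge0.
have c0 k : ~ vanishes_on C 'X_k -> coord C i0 k != 0.
  by move=> nk; apply/eqP => /(ratfun_eq0 (admissible_coord nv k)).
have -> : coord C i j = coord C i0 j / coord C i0 i.
  by rewrite /coord ratfun_div //; exact: admissible_coord.
have h := imin j nj; move/asboolP: nj => nj.
rewrite vge_neq0 ?mulf_neq0 ?invr_eq0 ?c0 //.
by rewrite (place_div (branch_place g)) ?c0 // subr_ge0.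
Qed.

(** The centre is the point whose coordinates are the residues of x_j / x_i, in a
    chart where these functions are regular at g: a form vanishing on C vanishes
    there, because its dehomogenisation is 0. *)
Lemma centre_exists : exists p i, centred g p /\ p i != 0.
Proof.
have [i [ni hi]] := branch_chart.
have [p hp] := choice (fun j => residue (branch_place g) (funfield_finite (C := C)) (hi j)).
have pi1 : p i = 1.
  apply: has_residue_uniq (hp i) _; rewrite /coord.
  have -> : ratfun C 'X_i 'X_i = ff_scalar C 1.
    rewrite ratfun_const; apply/ratfun_eq; first exact: admissible_coord.
      exact: admissible_scalar.
    by move=> x _; rewrite !(mevalC, meval1) mulr1 mul1r.
  exact: has_residue_const.
have val d a : a \is d.-homog -> has_residue (ratfun C a ('X_i ^+ d)) a.@[p].
  by move=> ha; rewrite -(mmap_coord ni ha); exact: has_residue_mmap.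
have pi0 : p i != 0 by rewrite pi1 oner_eq0.
have Cp : vpts C p.
  have [F hF CF] := vpts_closed C; rewrite CF; split; first by exists i.
  move=> a Fa; have [d ha] := hF a Fa.
  apply: has_residue_uniq (val d a ha) _.
  have -> : ratfun C a ('X_i ^+ d) = ff_scalar C 0; last exact: has_residue_const.
  rewrite (rmorph0 emb); apply/ratfun_eq0; first exact: admissible_form.
  by move=> x; rewrite CF => -[_]; apply.
have den d b : b \is d.-homog -> b.@[p] != 0 ->
    ratfun C b ('X_i ^+ d) != 0 /\ bval g (ratfun C b ('X_i ^+ d)) = 0.
  move=> hb b0.
  have := place_dominant (branch_place g) (x := emb b.@[p])
    (y := ratfun C b ('X_i ^+ d) - emb b.@[p]).
  rewrite [emb _ + _]addrC subrK bval_scalar fmorph_eq0 add0r; apply=> //.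
  exact: val.
have quo a b : admissible C a b -> b.@[p] != 0 -> exists d : nat, a \is d.-homog /\
    (ratfun C a b = 0 \/ (ratfun C a ('X_i ^+ d) != 0 /\
      bval g (ratfun C a b) = bval g (ratfun C a ('X_i ^+ d)))).
  move=> h b0; have [[d [ha hb]] nb] := h; exists d; split=> //.
  have [n0 v0] := den d b hb b0.
  rewrite -(@ratfun_div _ _ _ a b ('X_i ^+ d)) //; try exact: admissible_form.
  have [->|a0] := eqVneq (ratfun C a ('X_i ^+ d)) 0; first by left; rewrite mul0r.
  by right; rewrite (place_div (branch_place g)) // v0 subr0.
exists p, i; split=> //; split=> // f [a [b [h b0]]].
- move=> ->; have [d [ha [->|[n0 e]]]] := quo a b h b0; first by left.
  by right; rewrite e; have := has_residue_vge (val d a ha); rewrite vge_neq0.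
- move=> a0 ->; have [d [ha [->|[n0 e]]]] := quo a b h b0; first by left.
  right; rewrite e; have := val d a ha; rewrite a0 /has_residue (rmorph0 emb) subr0.
  by rewrite vge_neq0.
Qed.

End Residues.

Lemma bval_linear_ratio g p p' l l' : centred g p -> centred g p' ->
  l \is 1.-homog -> l' \is 1.-homog -> l.@[p] != 0 -> l'.@[p'] != 0 ->
  bval g (ratfun C l l') = 0.
Proof.
move=> [Cp vp _] [Cp' vp' _] hl hl' lp lp'.
have nl : ~ vanishes_on C l by move=> /(_ p Cp)/eqP; apply/negP.
have nl' : ~ vanishes_on C l' by move=> /(_ p' Cp')/eqP; apply/negP.
have h : admissible C l l' by exact: admissible_linear.
have h' : admissible C l' l by exact: admissible_linear.
have n0 : ratfun C l l' != 0 by apply/eqP => /(ratfun_eq0 h).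
have [|e|ge] := vp' (ratfun C l l'); first by exists l, l'.
  by rewrite e eqxx in n0.
have [|e|ge'] := vp (ratfun C l' l); first by exists l', l.
  by move/(ratfun_eq0 h'): e.
have e1 : ratfun C l l' * ratfun C l' l = 1.
  rewrite ratfunM // -[RHS](rmorph1 emb) /= ratfun_const.
  apply/ratfun_eq; [exact: admissibleM | exact: admissible_scalar |].
  by move=> x _; rewrite !(mevalC, meval1, mevalM); ring.
have n0' : ratfun C l' l != 0 by apply/eqP => /(ratfun_eq0 h').
have := bvalM g n0 n0'; rewrite e1 (place1 (branch_place g)); lia.
Qed.

Lemma bval_change_linear g e a l l' : a \is e.-homog -> l \is 1.-homog ->
  l' \is 1.-homog -> ~ vanishes_on C a -> ~ vanishes_on C l -> ~ vanishes_on C l' ->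
  bval g (ratfun C a (l ^+ e)) =
  bval g (ratfun C a (l' ^+ e)) + e%:Z * bval g (ratfun C l' l).
Proof.
move=> ha hl hl' na nl nl'.
have h (m : {mpoly L[w.+1]}) : m \is 1.-homog -> ~ vanishes_on C m -> admissible C a (m ^+ e).
  move=> hm nm; split; last exact: nonvanishingX.
  by exists e; split=> //; have := dhomogMn e hm; rewrite mul1n.
have hll : admissible C l' l by exact: admissible_linear.
rewrite -(placeX (branch_place g)) -bvalM; last first.
- by rewrite expf_neq0 //; apply/eqP => /(ratfun_eq0 hll).
- by apply/eqP => /(ratfun_eq0 (h _ hl' nl')).
congr bval; rewrite ratfunX // ratfunM //; [|exact: h|exact: admissibleX].
apply/ratfun_eq; [exact: h | apply: admissibleM; [exact: h | exact: admissibleX] |].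
by move=> x _; rewrite !mevalM; ring.
Qed.

Section HyperplaneDivisor.
Context (i0 : 'I_w.+1) (nv : ~ vanishes_on C 'X_i0).

(** D0 is the section by the hyperplane x_i0 = 0.  At a branch centred off
    x_i = 0, the multiplicity of phi is the value of phi / x_i^e, which differs
    from that of phi / x_i0^e by e times the value of x_i0 / x_i. *)
Lemma hyperplane_divisor : exists D0 : wset C,
  forall g e (phi : dhomog w.+1 L e), ~ vanishes_on C (val phi) -> forall n,
    int_mult g phi n <->
    n = bval g (ratfun C (val phi) ('X_i0 ^+ e)) + e%:Z * coeff g D0.
Proof.
have [pi hpi] := @choice _ _ (fun g (pi : hcoord L w * 'I_w.+1) =>
    centred g pi.1 /\ pi.1 pi.2 != 0) (fun g => let: ex_intro p (ex_intro i h) :=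
    centre_exists g in ex_intro _ (p, i) h).
have nvi g : ~ vanishes_on C 'X_(pi g).2.
  have [[Cp _ _] h] := hpi g; exact: coord_nonvanishing Cp h.
pose F g := bval g (ratfun C 'X_i0 'X_(pi g).2).
have [i|S hS] := @choice _ _ (fun i (s : seq (branch C)) => ~ vanishes_on C 'X_i ->
    forall g, bval g (ratfun C 'X_i0 'X_i) != 0 -> g \in s).
  have [v|ni] := pselect (vanishes_on C 'X_i); first by exists [::].
  have c0 : ratfun C 'X_i0 'X_i != 0.
    by apply/eqP => /(ratfun_eq0 (admissible_coord ni i0)).
  have [s [_ hs _]] := principal_degree (funfield_finite (C := C))
    branch_place branch_ext branch_has_zero c0.
  by exists s.
have [||D0 [hD0 _]] := @wset_of_fun F (undup (flatten [seq S i | i : 'I_w.+1])).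
- exact: undup_uniq.
- move=> g Fg; rewrite mem_undup; apply/flattenP; exists (S (pi g).2).
    by apply: map_f; rewrite mem_enum.
  exact: hS (nvi g) g Fg.
exists D0 => g e phi nphi n; rewrite hD0 /F.
have hphi : val phi \is e.-homog by exact: (valP phi).
have [cg pig] := hpi g.
rewrite -(@bval_change_linear g e _ 'X_(pi g).2 'X_i0) //; try exact: coord_homog; last first.
split=> [[p [l [cp hl lp ->]]]|->]; last first.
  exists (pi g).1, 'X_(pi g).2; rewrite mevalXU; split=> //; exact: coord_homog.
have nl : ~ vanishes_on C l by case: cp => Cp _ _ /(_ p Cp)/eqP; apply/negP.
rewrite (@bval_change_linear g e _ l 'X_(pi g).2) //; last exact: coord_homog.
by rewrite (bval_linear_ratio cg cp (coord_homog _ _) hl) ?mulr0 ?addr0 // mevalXU.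
Qed.

End HyperplaneDivisor.

(** If z is the dehomogenisation of phi, each affine coordinate satisfies a
    primitive relation over L[z]; at a zero of phi, where z = 0, the relation
    becomes a nonzero polynomial equation over L for that coordinate. *)
Lemma zeros_in_chart e (phi : dhomog w.+1 L e) i : ~ vanishes_on C (val phi) ->
  exists R : seq L, forall p, vpts C p -> p i != 0 -> (val phi).@[p] = 0 ->
    forall j, p j / p i \in R.
Proof.
move=> nphi; have hphi : val phi \is e.-homog by exact: (valP phi).
have [v|ni] := pselect (vanishes_on C 'X_i).
  by exists [::] => p Cp pi; have := v p Cp; rewrite mevalXU => /eqP; rewrite (negbTE pi).
pose z := ratfun C (val phi) ('X_i ^+ e).
have hz := admissible_form ni hphi.
have zval p : p i != 0 -> (val phi).@[p] = 0 -> has_value p z 0.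
  move=> pi e0; have := has_value_ratfun (p := p) hz; rewrite e0 mul0r; apply.
  by rewrite rmorphXn /= mevalXU expf_neq0.
have [[c ec]|/forallNP nz] := pselect (exists c, z = emb c).
  exists [::] => p Cp pi /(zval p pi) h; exfalso; apply: nphi; apply/(ratfun_eq0 hz).
  rewrite -/z ec; have -> : c = 0; last exact: (rmorph0 emb).
  by apply: has_value_uniq Cp _ h; rewrite ec; exact: has_value_const.
have {}nz : nonconstant emb z by move=> c; apply/eqP; exact: nz.
have [j|q hq] := @choice _ _ (fun j (q : {poly L}) => q != 0 /\
    forall p, vpts C p -> p i != 0 -> (val phi).@[p] = 0 -> root q (p j / p i)).
  have [D /(primitive_relation (nonconstant_neq0 nz))[c hc [k ck]]] :=
    power_relation z (coord C i j).
  exists (\poly_(m < D) (if insub m is Some m' then (c m')`_0 else 0)); split.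
    apply: contra_neq ck => /(congr1 (fun q : {poly L} => q`_k)).
    by rewrite coef_poly ltn_ord valK coef0.
  move=> p Cp pi e0; apply/rootP; rewrite horner_poly.
  have h0 : has_value p (\sum_m ev emb z (c m) * coord C i j ^+ m)
      (\sum_(m < D) (c m).[0] * (p j / p i) ^+ m).
    have hv := has_value_coord ni j pi.
    apply: (relation_sum (emb := emb)); [exact: has_value_const | by move=> *; exact: has_valueD |].
    move=> m; apply: has_valueM.
      apply: relation_ev; [exact: has_value_const | by move=> *; exact: has_valueD
        | by move=> *; exact: has_valueM | exact: zval].
    by apply: (relationX (emb := emb)); [exact: has_value_const | by move=> *; exact: has_valueM |].
  rewrite hc -(rmorph0 emb) in h0.
  rewrite [RHS](has_value_uniq Cp (has_value_const C p 0) h0).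
  by apply: eq_bigr => m _; rewrite valK horner_coef0.
pose R j := sval (closed_field_poly_normal (q j)).
have hR j : q j = lead_coef (q j) *: \prod_(r <- R j) ('X - r%:P).
  exact: svalP (closed_field_poly_normal (q j)).
exists (flatten [seq R j | j : 'I_w.+1]) => p Cp pi e0 j.
apply/flattenP; exists (R j); first by apply: map_f; rewrite mem_enum.
have [q0 /(_ p Cp pi e0)] := hq j.
by rewrite (hR j) rootZ ?lead_coef_eq0 // root_prod_XsubC.
Qed.

Lemma In_map_mem (T : eqType) (U : Type) (F : T -> U) (s : seq T) x :
  x \in s -> List.In (F x) [seq F y | y <- s].
Proof.
elim: s => //= y s IH; rewrite inE => /predU1P[->|/IH]; first by left.
by right.
Qed.

Lemma mem_map_In (T : Type) (U : eqType) (F : T -> U) (s : seq T) x :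
  List.In x s -> F x \in [seq F y | y <- s].
Proof.
elim: s => //= y s IH [->|/IH h]; rewrite inE; first by rewrite eqxx.
by rewrite h orbT.
Qed.

(** If phi vanished on C and had finitely many zeros, C would be finite, and a
    nonconstant function would be a root of the polynomial whose roots are its
    finitely many values. *)
Lemma finite_intersection_nonvanishing e (phi : dhomog w.+1 L e) :
  finite_intersection C phi <-> ~ vanishes_on C (val phi).
Proof.
split=> [[s hs] vphi|nphi]; last first.
  have [R hR] := choice (fun i => zeros_in_chart i nphi).
  pose S := flatten [seq R i | i : 'I_w.+1].
  exists [seq (fun j => val (h j)) | h : {ffun 'I_w.+1 -> seq_sub S}] => p Cp e0.
  have [i pi] := variety_is_point Cp.
  have mS j : p j / p i \in S.
    by apply/flattenP; exists (R i); [by apply: map_f; rewrite mem_enum | exact: hR].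
  exists (fun j => val ([ffun j => SeqSub (mS j)] j)).
    exact: (In_map_mem (fun (h : {ffun _ -> _}) j => val (h j)) (mem_enum _ _)).
  by exists (p i) => // j; rewrite ffunE /= mulrC divfK.
have [[t tind] _] := curve_dim1 C.
have nx : nonconstant emb (t ord0).
  move=> c; apply/eqP => ec; have := tind ('X_ord0 - c%:MP).
  rewrite mmapB mmapX mmap1U mmapC ec subrr => /(_ erefl)/(congr1 (mcoeff U_(ord0))).
  rewrite mcoeffB mcoeffX eqxx mcoeffC mcoeff0 mnm1_eq0 mulr0 subr0 => /eqP.
  by rewrite oner_eq0.
have [a [b [hab xE]]] := ratfun_repr (t ord0).
have [[d [ha hb]] nb] := hab.
pose q : {poly L} := \prod_(c <- [seq a.@[y] / b.@[y] | y <- s]) ('X - c%:P).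
have q0 : q != 0 by exact/monic_neq0/monic_prod_XsubC.
move/eqP: q0; apply; apply: (ev_eq0 nx).
apply: (ff_eq0_away hb nb) => p Cp bp.
have [y ys [c c0 pE]] := hs p Cp (vphi p Cp).
have hx : has_value p (t ord0) (a.@[y] / b.@[y]).
  have := has_value_ratfun hab bp; rewrite xE.
  by rewrite (meval_homogZ ha pE) (meval_homogZ hb pE) -mulf_div divff ?mul1r // expf_neq0.
have -> : 0 = q.[a.@[y] / b.@[y]].
  apply/esym/rootP; rewrite root_prod_XsubC.
  exact: (mem_map_In (fun y => a.@[y] / b.@[y])).
apply: relation_ev hx; [exact: has_value_const | by move=> *; exact: has_valueD
        | by move=> *; exact: has_valueM].
Qed.

End Branches.

(** * Linear equivalence and rational functions *)

Section LinearEquivalence.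
Context (L : closedFieldType) (w : nat) (C : curve L w).
Local Notation emb := (ff_scalar C : {rmorphism L -> funfield C}).
Implicit Types (g : branch C) (f : funfield C) (A B W D : wset C).
Implicit Types (a b : {mpoly L[w.+1]}).

Lemma int_mult_diff g e (phi psi : dhomog w.+1 L e) m n :
  ~ vanishes_on C (val phi) -> ~ vanishes_on C (val psi) ->
  int_mult g phi m -> int_mult g psi n ->
  bval g (ratfun C (val phi) (val psi)) = m - n.
Proof.
have [i0 nv] := exists_coord C; have [D0 hD0] := hyperplane_divisor nv.
have hphi : val phi \is e.-homog by exact: (valP phi).
have hpsi : val psi \is e.-homog by exact: (valP psi).
move=> nphi npsi /(hD0 g e phi nphi) -> /(hD0 g e psi npsi) ->.
rewrite -(@ratfun_div _ _ _ _ _ ('X_i0 ^+ e)) //; try exact: admissible_form.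
rewrite (place_div (branch_place g)); first by ring.
- by apply/eqP => /(ratfun_eq0 (admissible_form nv hphi)).
- by apply/eqP => /(ratfun_eq0 (admissible_form nv hpsi)).
Qed.

Lemma eff_equiv_function A B : eff_equiv A B ->
  exists2 f, f != 0 & forall g, bval g f = coeff g A - coeff g B.
Proof.
move=> [_ _ [n [r [G [_ _ [e [Sigma [W0 [m [_ _ _ _ [_ ->]]]]]]]]]]].
move=> [W1 [phi [_ /finite_intersection_nonvanishing nphi c1]] <-].
move=> [W2 [psi [_ /finite_intersection_nonvanishing npsi c2]] <-].
have h : admissible C (val phi) (val psi).
  by split=> //; exists e; split; [exact: (valP phi) | exact: (valP psi)].
exists (ratfun C (val phi) (val psi)); first by apply/eqP => /(ratfun_eq0 h).
move=> g; rewrite (int_mult_diff nphi npsi (c1 g) (c2 g)) !coeffB; ring.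
Qed.

Section Converse.
Context (i0 : 'I_w.+1) (nv : ~ vanishes_on C 'X_i0) (D0 : wset C).
Context (hD0 : forall g e (phi : dhomog w.+1 L e), ~ vanishes_on C (val phi) ->
  forall n, int_mult g phi n <->
    n = bval g (ratfun C (val phi) ('X_i0 ^+ e)) + e%:Z * coeff g D0).

Local Notation dehomog a := (mmap emb (coord C i0) a).

(** The multiplicity of the form a, of degree d, at g. *)
Definition form_order d a g : int := bval g (dehomog a) + d%:Z * coeff g D0.

Lemma cut_outP e (phi : dhomog w.+1 L e) W : ~ vanishes_on C (val phi) ->
  cut_out phi W <-> forall g, coeff g W = form_order e (val phi) g.
Proof.
move=> nphi; have hphi : val phi \is e.-homog by exact: (valP phi).
by split=> h g; have := h g; rewrite (hD0 _ nphi) /form_order (mmap_coord nv hphi).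
Qed.

Lemma form_order_ge0 d a g : a \is d.-homog -> ~ vanishes_on C a ->
  0 <= form_order d a g.
Proof.
move=> ha na; have [p [l [[Cp vp _] hl lp]]] := proj2 (hD0 g (phi := DHomog ha) na _) erefl.
rewrite /form_order (mmap_coord nv ha) /= => ->.
have hal : admissible C a (l ^+ d).
  split; last by apply: nonvanishingX => // /(_ p Cp)/eqP; apply/negP.
  by exists d; split=> //; have := dhomogMn d hl; rewrite mul1n.
have [|e|//] := vp (ratfun C a (l ^+ d)).
  by exists a, (l ^+ d); rewrite rmorphXn /= expf_neq0.
by rewrite e bval0.
Qed.

Lemma form_orderM d e a b g : a \is d.-homog -> b \is e.-homog ->
  ~ vanishes_on C a -> ~ vanishes_on C b ->
  form_order (d + e) (a * b) g = form_order d a g + form_order e b g.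
Proof.
move=> ha hb na nb; rewrite /form_order rmorphM /= bvalM.
- by rewrite PoszD; ring.
- exact: mmap_coord_neq0 ha na.
- exact: mmap_coord_neq0 hb nb.
Qed.

Lemma bval_ratfun d a b g : a \is d.-homog -> b \is d.-homog ->
  ~ vanishes_on C a -> ~ vanishes_on C b ->
  bval g (ratfun C a b) = form_order d a g - form_order d b g.
Proof.
move=> ha hb na nb; have h : admissible C a b by split=> //; exists d.
rewrite (ratfun_mmap nv h) (place_div (branch_place g)) /form_order; first by ring.
- exact: mmap_coord_neq0 ha na.
- exact: mmap_coord_neq0 hb nb.
Qed.

Lemma form_divisor e (phi : dhomog w.+1 L e) : ~ vanishes_on C (val phi) ->
  exists W, cut_out phi W /\ deg W = e%:Z * deg D0.
Proof.
move=> nphi; have hphi : val phi \is e.-homog by exact: (valP phi).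
have [W [hW dW]] := principal_divisor (mmap_coord_neq0 nv hphi nphi).
exists (W + D0 *+ e); split; last by rewrite degD degMn dW add0r -mulr_natl natz.
apply/(cut_outP _ nphi) => g.
by rewrite coeffD coeffMn hW /form_order -mulr_natl natz.
Qed.

Lemma curve_degree_hyperplane : curve_degree C (deg D0).
Proof.
pose l := DHomog (coord_homog L i0); exists l, D0.
have nl : ~ vanishes_on C (val l) by exact: nv.
split=> //; first exact/finite_intersection_nonvanishing.
apply/(cut_outP _ nl) => g; rewrite /form_order (mmap_coord nv (coord_homog L i0)) expr1.
have -> : ratfun C 'X_i0 'X_i0 = ff_scalar C 1.
  rewrite ratfun_const; apply/ratfun_eq; first exact: admissible_coord.
    exact: admissible_scalar.
  by move=> x _; rewrite !(mevalC, meval1) mulr1 mul1r.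
by rewrite bval_scalar add0r mul1r.
Qed.

(** For each g in s, the numerator of a uniformiser at g vanishes at g; the form
    is the product of these numerators. *)
Lemma form_through (s : seq (branch C)) : exists d c,
  [/\ c \is d.-homog, ~ vanishes_on C c
    & forall g, (count_mem g s)%:Z <= form_order d c g].
Proof.
elim: s => [|g s [d [c [hc nc h]]]].
  have n1 : ~ vanishes_on C (1 : {mpoly L[w.+1]}).
    have [[x Xx] _] := vpts_irreducible C.
    by move=> /(_ x Xx)/eqP; rewrite meval1 oner_eq0.
  by exists 0%N, 1; split=> // [|g]; [exact: dhomog1 | apply: form_order_ge0 => //; exact: dhomog1].
have [t t0 vt] := bval_normalised g.
have [a [b [hab tE]]] := ratfun_repr t.
have [[e [ha hb]] nb] := hab.
have na : ~ vanishes_on C a.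
  by move=> va; case/eqP: t0; rewrite tE; apply/(ratfun_eq0 hab).
exists (d + e)%N, (c * a); split; [exact: dhomogM | by case/(vanishes_onM hc ha) |].
move=> g'; rewrite form_orderM //= PoszD addrC lerD //.
have [e1|_] := eqVneq g g'; last exact: form_order_ge0.
have := form_order_ge0 g' hb nb; have := bval_ratfun g' ha hb na nb.
by rewrite -tE -e1 vt /=; lia.
Qed.

(** The dimension of a series is a minimum over a nonempty set, since Sigma is a
    subsystem of itself. *)
Lemma series_dim_exists e (Sigma : {vspace dhomog w.+1 L e}) :
  (0 < \dim Sigma)%N -> exists r, series_dim C Sigma r.
Proof.
move=> dS; pose P r := `[< series_within C Sigma r >].
have exP : exists r, P r.
  exists (\dim Sigma).-1; apply/asboolP; exists Sigma; split=> //.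
  by rewrite prednK.
have [r /asboolP hr rmin] := ex_minnP exP; exists r; split=> // s hs.
by apply: rmin; exact/asboolP.
Qed.

(** A and B are cut out by the pencil spanned by ac and bc, where f = a / b and c
    is a form through B, after removing W0 = div (bc) - B. *)
Lemma eff_equiv_of_function A B f : fgle 0 A -> fgle 0 B -> deg A = deg B ->
  f != 0 -> (forall g, bval g f = coeff g A - coeff g B) -> eff_equiv A B.
Proof.
move=> A0 B0 dAB f0 hf; have [a [b [hab fE]]] := ratfun_repr f.
have [[d [ha hb]] nb] := hab.
have na : ~ vanishes_on C a.
  by move=> va; case/eqP: f0; rewrite fE; apply/(ratfun_eq0 hab).
(* the form c, whose divisor is at least B *)
have [s _ hs] := list_of_multiplicities (dom B) (fun g => `|coeff g B|%N).
have [k [c [hc nc cB]]] := form_through s.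
have {}cB g : coeff g B <= form_order k c g.
  apply: le_trans (cB g); have [/hs h|/coeff_outdom ->//] := boolP (g \in dom B).
  by rewrite (le_trans (ler_norm _)) // -abszE lez_nat.
have [nac nbc] : ~ vanishes_on C (a * c) /\ ~ vanishes_on C (b * c).
  by split; [case/(vanishes_onM ha hc) | case/(vanishes_onM hb hc)].
pose phiA := DHomog (dhomogM ha hc); pose phiB := DHomog (dhomogM hb hc).
have nA : ~ vanishes_on C (val phiA) by [].
have nB : ~ vanishes_on C (val phiB) by [].
have [WA [cutA _]] := form_divisor nA; have [WB [cutB dWB]] := form_divisor nB.
pose Sigma := (<[phiA]> + <[phiB]>)%VS; pose W0 := WB - B.
have Ain : phiA \in Sigma by apply: (subvP (addvSl _ _)); exact: memv_line.
have Bin : phiB \in Sigma by apply: (subvP (addvSr _ _)); exact: memv_line.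
have WAE g : coeff g WA = coeff g W0 + coeff g A.
  have := proj1 (cut_outP _ nA) cutA g; have := proj1 (cut_outP _ nB) cutB g.
  rewrite /W0 coeffB /= !form_orderM // => -> ->.
  have := bval_ratfun g ha hb na nb; rewrite -fE hf; lia.
have W00 g : 0 <= coeff g W0.
  have := proj1 (cut_outP _ nB) cutB g; have := cB g.
  have := form_order_ge0 g hb nb.
  rewrite /W0 coeffB /= form_orderM // => h1 h2 ->; lia.
have [|r hr] := @series_dim_exists _ Sigma.
  rewrite lt0n dimv_eq0; apply/eqP => e0; move: Bin; rewrite e0 memv0 => /eqP h.
  by apply: nB; rewrite h => x _; rewrite raddf0.
have dA : 0 <= deg A.
  rewrite -[A]freeg_sumE raddf_sum; apply: sumr_ge0 => g _ /=.
  by rewrite degU; exact: (fgposP _ A0).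
have [n dn] : exists n : nat, deg A = n by exists `|deg A|%N; rewrite gez0_abs.
split=> //; exists n, r, [set W - W0 | W in @series L w C (d + k)%N Sigma]%classic.
split=> //; first by rewrite -dAB.
- exists (d + k)%N, Sigma, W0, ((d + k)%N%:Z * deg D0); split=> //.
  + by exists phiA => //; exact/finite_intersection_nonvanishing.
  + by exists (deg D0) => //; exact: curve_degree_hyperplane.
  + split; first exact/fgposP.
    move=> W [phi [phiS /finite_intersection_nonvanishing nphi cutW]]; apply/fgleP => g.
    have /memv_addP[_ /vlineP[u ->] [_ /vlineP[v ->] phiE]] := phiS.
    have hphi : val phi \is (d + k).-homog by exact: (valP phi).
    have g0 := mmap_coord_neq0 nv hphi nphi.
    rewrite (proj1 (cut_outP _ nphi) cutW g) /form_order -lerBlDr.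
    have valE : val phi = u *: val phiA + v *: val phiB by rewrite phiE.
    rewrite -(vge_neq0 (bval g) _ g0) valE mmapD.
    have hg := branch_place g.
    (* each of the two terms of phi has order at least that of W0 at g *)
have part (z : L) (psi : dhomog w.+1 L (d + k)) : ~ vanishes_on C (val psi) ->
        coeff g W0 <= form_order (d + k) (val psi) g ->
        vge (bval g) (coeff g W0 - (d + k)%N%:Z * coeff g D0) (dehomog (z *: val psi)).
      move=> npsi le; rewrite mmapZ; apply: (vgeMl hg); first exact: (vge_const hg).
      by rewrite vge_neq0 ?lerBlDr // (mmap_coord_neq0 nv (valP psi)).
    apply: (vgeD hg); apply: part => //.
      by rewrite -(proj1 (cut_outP _ nA) cutA) WAE lerDl; exact: (fgposP _ A0).
    rewrite -(proj1 (cut_outP _ nB) cutB) /W0 coeffB gerBl; exact: (fgposP _ B0).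
  + by split=> //; rewrite /W0 degB dWB -dn dAB; ring.
- exists WA; first by exists phiA; split=> //; exact/finite_intersection_nonvanishing.
  by apply/eqP/freeg_eqP => g; rewrite coeffB WAE addrC addKr.
- exists WB; first by exists phiB; split=> //; exact/finite_intersection_nonvanishing.
  by rewrite /W0 opprB addrC subrK.
Qed.

End Converse.

Theorem eff_equivP A B : eff_equiv A B <->
  [/\ fgle 0 A, fgle 0 B, deg A = deg B
    & exists2 f, f != 0 & forall g, bval g f = coeff g A - coeff g B].
Proof.
split=> [h|[A0 B0 dAB [f f0 hf]]].
  split; [by case: h | by case: h | | exact: eff_equiv_function].
  by case: h => _ _ [n [r [G [-> ->]]]].
have [i0 nv] := exists_coord C; have [D0 hD0] := hyperplane_divisor nv.
exact (eff_equiv_of_function nv hD0 A0 B0 dAB f0 hf).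
Qed.

End LinearEquivalence.

Section WeightedSets.
Context (L : closedFieldType) (w1 w2 : nat) (C1 : curve L w1) (C2 : curve L w2).
Context (Phi : birational C1 C2).
Implicit Types (A B : wset C2).

Lemma branch_pullK (g : branch C2) :
  branch_pull (bir_sym Phi) (branch_pull Phi g) = g.
Proof. by apply: branch_ext => f; exact: (congr1 (bval g) (ff_pullK Phi f)). Qed.

Lemma branch_pullVK (g : branch C1) : branch_pull Phi (branch_pull (bir_sym Phi) g) = g.
Proof. by apply: branch_ext => f; exact: (congr1 (bval g) (ff_pullK (bir_sym Phi) f)). Qed.

Lemma bval_branch_pull (g : branch C2) (f : funfield C2) :
  bval (branch_pull Phi g) (ff_pull (bir_map Phi) f) = bval g f.
Proof. exact: (congr1 (bval g) (ff_pullK Phi f)). Qed.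

Lemma coeff_wset_pull A (g : branch C1) :
  coeff g (wset_pull Phi A) = coeff (branch_pull (bir_sym Phi) g) A.
Proof.
rewrite -[in RHS](freeg_sumE A) /wset_pull !raddf_sum /=; apply: eq_bigr => h _.
rewrite !coeffU; congr (_ * _%:R); congr nat_of_bool; apply/eqP/eqP => [<-|->].
  by rewrite branch_pullK.
exact: branch_pullVK.
Qed.

Lemma deg_wset_pull A : deg (wset_pull Phi A) = deg A.
Proof.
rewrite -[in RHS](freeg_sumE A) /wset_pull !raddf_sum /=.
by apply: eq_bigr => h _; rewrite !degU.
Qed.

Lemma eff_equiv_pull A B : eff_equiv A B ->
  eff_equiv (wset_pull Phi A) (wset_pull Phi B).
Proof.
move=> /eff_equivP[/fgposP A0 /fgposP B0 dAB [f f0 hf]]; apply/eff_equivP.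
rewrite !deg_wset_pull; split=> //.
- by apply/fgposP => g; rewrite coeff_wset_pull.
- by apply/fgposP => g; rewrite coeff_wset_pull.
exists (ff_pull (bir_map Phi) f); first by rewrite fmorph_eq0.
move=> g; rewrite !coeff_wset_pull -hf -bval_branch_pull.
by rewrite branch_pullVK.
Qed.

Lemma wset_pull_pos_neg A B : wset_pull Phi (fgpos A + fgneg B) =
  fgpos (wset_pull Phi A) + fgneg (wset_pull Phi B).
Proof.
apply/eqP/freeg_eqP => g.
by rewrite !(coeff_wset_pull, coeffD, coeff_fgposE, coeff_fgnegE).
Qed.

End WeightedSets.

Lemma wset_pullK (L : closedFieldType) (w1 w2 : nat) (C1 : curve L w1)
    (C2 : curve L w2) (Phi : birational C1 C2) (A : wset C2) :
  wset_pull (bir_sym Phi) (wset_pull Phi A) = A.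
Proof.
apply/eqP/freeg_eqP => g; rewrite !coeff_wset_pull.
by congr coeff; exact: branch_pullK.
Qed.

Theorem theorem4p32 (L : closedFieldType) (w1 w2 : nat)
    (C1 : curve L w1) (C2 : curve L w2) (Phi : birational C1 C2) :
  (forall A B : wset C2, fgle 0 A -> fgle 0 B -> deg A = deg B ->
     (eff_equiv A B <-> eff_equiv (wset_pull Phi A) (wset_pull Phi B))) /\
  (forall A B : wset C2, deg A = deg B ->
     (gen_equiv A B <-> gen_equiv (wset_pull Phi A) (wset_pull Phi B))).
Proof.
have eff A B : eff_equiv A B <-> eff_equiv (wset_pull Phi A) (wset_pull Phi B).
  split=> [|/(eff_equiv_pull (bir_sym Phi))]; first exact: eff_equiv_pull.
  by rewrite !wset_pullK.
split=> [A B _ _ _|A B _]; first exact: eff.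
by rewrite /gen_equiv !deg_wset_pull -!wset_pull_pos_neg -eff.
Qed.
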